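(* Consider the multi-buffer packet scheduling problem in which all packets have the same (common) deadline but arbitrary non-negative values. There exists an optimal offline algorithm for this problem running in $O(n^2 \log n)$ time, where $n$ is the number of packets released.
   Context: Multi-buffer model: time is discretized into integer time steps. A network switch has $m$ buffers $Q_1, \ldots, Q_m$ with capacities $B_1, \ldots, B_m \in \mathbb{Z}^+$; at any time the number of packets residing in buffer $Q_i$ cannot exceed $B_i$. Packets arrive over time; each packet $p$ has an integer release (arrival) time $r_p$, a non-negative value $v_p$, an integer deadline $d_p$, and a designated buffer $b_p \in \{Q_1,\ldots,Q_m\}$ which is the only buffer it may reside in. An arriving packet may be accepted into its designated buffer or dropped; packets already in buffers may be dropped at any time before transmission, and a dropped packet can never be delivered. In each time step at most one pending packet may be sent, and it may come from any buffer. The objective is to maximize the total value of packets sent by their respective deadlines. Here all packets share a common deadline $D$. An offline algorithm knows the entire input in advance; an optimal offline algorithm computes a feasible schedule of maximum total value. *)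

(* Defs.v *)
From HB Require Import structures.
From mathcomp Require Import all_boot all_order all_algebra.

Set Implicit Arguments.
Unset Strict Implicit.
Unset Printing Implicit Defensive.

Import Order.TTheory GRing.Theory Num.Theory.
Local Open Scope ring_scope.

Record instance (R : realDomainType) := Instance {
  npackets : nat;
  nbuffers : nat;
  capacity : 'I_nbuffers -> nat;
  release : 'I_npackets -> int;
  deadline : 'I_npackets -> int;
  value : 'I_npackets -> R;
  buffer : 'I_npackets -> 'I_nbuffers;
  capacity_gt0 : forall i, (0 < capacity i)%N;
  value_ge0 : forall p, 0 <= value p
}.

Definition common_deadline (R : realDomainType) (I : instance R) : Prop :=
  exists D : int, forall p, @deadline R I p = D.

(* In time step t, packets with release time t arrive and are accepted or
   dropped, other packets may be dropped as well, and then at most one pending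
   packet is sent.  [content t] is the set of packets in the buffers just before
   the transmission of step t, when the buffers are fullest; [send p] is the
   step in which p is sent, if any. *)
Record schedule (n : nat) := Schedule {
  content : int -> {set 'I_n};
  send : 'I_n -> option int
}.

(* By the second clause, a packet that is not accepted on arrival, or that is
   later dropped or sent, never (re)appears in its buffer. *)
Record feasible (R : realDomainType) (I : instance R)
    (S : schedule (npackets I)) : Prop := Feasible {
  feasible_released : forall t p, p \in content S t -> release p <= t;
  feasible_resident : forall t p, p \in content S t -> release p < t ->
    p \in content S (t - 1) /\ send S p <> Some (t - 1);
  feasible_capacity : forall t i,
    (#|[set p in content S t | buffer p == i]| <= capacity i)%N;
  feasible_pending : forall t p, send S p = Some t -> p \in content S t;
  feasible_one_send : forall t p q,
    send S p = Some t -> send S q = Some t -> p = q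
}.

Definition on_time (R : realDomainType) (I : instance R)
    (S : schedule (npackets I)) (p : 'I_(npackets I)) : bool :=
  if send S p is Some t then t <= deadline p else false.

Definition total_value (R : realDomainType) (I : instance R)
    (S : schedule (npackets I)) : R :=
  \sum_(p < npackets I | on_time S p) value p.

Definition optimal (R : realDomainType) (I : instance R)
    (S : schedule (npackets I)) : Prop :=
  feasible S /\
  forall S' : schedule (npackets I), feasible S' ->
    total_value S' <= total_value S.

(* Unit-cost random access machine, presented as structured programs over
   finitely many integer variables and integer arrays, both named by natural
   numbers.  There is no multiplication, so that one operation increases the
   maximal bit length of the numbers in the store by at most one.  Packet values
   can only be compared with one another: programs do not depend on the ordered
   domain of values, and run unchanged on machines that also have arithmetic on
   values. *)

Inductive expr : Type :=
| Const of int
| Var of nat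
| Get of nat & expr
| Plus of expr & expr
| Minus of expr & expr
| Half of expr.

Inductive test : Type :=
| Le of expr & expr
| LeValue of expr & expr
| Not of test
| And of test & test.

Inductive cmd : Type :=
| Skip
| Assign of nat & expr
| Put of nat & expr & expr
| Seq of cmd & cmd
| If of test & cmd & cmd
| While of test & cmd.

Record store := Store {
  var : nat -> int;
  arr : nat -> int -> int
}.

Definition set_var (s : store) (x : nat) (z : int) : store :=
  Store (fun y => if y == x then z else var s y) (arr s).

Definition set_arr (s : store) (a : nat) (k z : int) : store :=
  Store (var s)
    (fun b j => if (b == a) && (j == k) then z else arr s b j).

Fixpoint eval (s : store) (e : expr) : int :=
  match e with
  | Const z => z
  | Var x => var s x
  | Get a e1 => arr s a (eval s e1)
  | Plus e1 e2 => eval s e1 + eval s e2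
  | Minus e1 e2 => eval s e1 - eval s e2
  | Half e1 => (eval s e1 %/ 2)%Z
  end.

Fixpoint expr_cost (e : expr) : nat :=
  match e with
  | Const _ | Var _ => 1
  | Get _ e1 | Half e1 => (expr_cost e1).+1
  | Plus e1 e2 | Minus e1 e2 => (expr_cost e1 + expr_cost e2).+1
  end.

(* [val k] is the value of the packet of index k. *)
Fixpoint eval_test (R : realDomainType) (val : int -> R) (s : store) (b : test)
    : bool :=
  match b with
  | Le e1 e2 => eval s e1 <= eval s e2
  | LeValue e1 e2 => val (eval s e1) <= val (eval s e2)
  | Not b1 => ~~ eval_test val s b1
  | And b1 b2 => eval_test val s b1 && eval_test val s b2
  end.

Fixpoint test_cost (b : test) : nat :=
  match b with
  | Le e1 e2 | LeValue e1 e2 => (expr_cost e1 + expr_cost e2).+1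
  | Not b1 => (test_cost b1).+1
  | And b1 b2 => (test_cost b1 + test_cost b2).+1
  end.

(* [exec val c s t s']: started in store s, the program c halts after t steps in
   store s'. *)
Inductive exec (R : realDomainType) (val : int -> R)
    : cmd -> store -> nat -> store -> Prop :=
| exec_skip s : exec val Skip s 1 s
| exec_assign s x e :
    exec val (Assign x e) s (expr_cost e).+1 (set_var s x (eval s e))
| exec_put s a e1 e2 :
    exec val (Put a e1 e2) s (expr_cost e1 + expr_cost e2).+1
      (set_arr s a (eval s e1) (eval s e2))
| exec_seq s s1 s2 c1 c2 t1 t2 :
    exec val c1 s t1 s1 -> exec val c2 s1 t2 s2 ->
    exec val (Seq c1 c2) s (t1 + t2) s2
| exec_if s s1 b c1 c2 t :
    exec val (if eval_test val s b then c1 else c2) s t s1 ->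
    exec val (If b c1 c2) s (test_cost b + t).+1 s1
| exec_while_false s b c :
    eval_test val s b = false ->
    exec val (While b c) s (test_cost b).+1 s
| exec_while_true s s1 s2 b c t1 t2 :
    eval_test val s b = true ->
    exec val c s t1 s1 -> exec val (While b c) s1 t2 s2 ->
    exec val (While b c) s (test_cost b + t1 + t2).+1 s2.

Lemma exec_det (R : realDomainType) (val : int -> R) c s t1 s1 t2 s2 :
  exec val c s t1 s1 -> exec val c s t2 s2 -> t1 = t2 /\ s1 = s2.
Proof.
move=> H1; elim: H1 t2 s2 => {c s t1 s1}.
- by move=> s t2 s2 H; inversion H; subst.
- by move=> s x e t2 s2 H; inversion H; subst.
- by move=> s a e1 e2 t2 s2 H; inversion H; subst.
- move=> s s1 s2 c1 c2 t1 t2 _ IH1 _ IH2 t3 s3 H; inversion H; subst.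
  match goal with H : exec _ c1 _ _ _ |- _ => case: (IH1 _ _ H) => ? ? end.
  subst.
  by match goal with H : exec _ c2 _ _ _ |- _ => case: (IH2 _ _ H) => ? ? end;
    subst.
- move=> s s1 b c1 c2 t _ IH t3 s3 H; inversion H; subst.
  by match goal with H : exec _ (if _ then _ else _) _ _ _ |- _ =>
    case: (IH _ _ H) => ? ? end; subst.
- by move=> s b c bF t3 s3 H; inversion H; subst => //; congruence.
- move=> s s1 s2 b c t1 t2 bT _ IH1 _ IH2 t3 s3 H; inversion H; subst.
    by congruence.
  match goal with H : exec _ c _ _ _ |- _ => case: (IH1 _ _ H) => ? ? end.
  subst.
  by match goal with H : exec _ (While _ _) _ _ _ |- _ =>
    case: (IH2 _ _ H) => ? ? end; subst.
Qed.

Definition table (V : nmodType) (n : nat) (f : 'I_n -> V) (k : int) : V :=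
  if k is Posz j then oapp f 0 (insub j) else 0.

(* Packets are given in arbitrary order; all other cells are initially 0. *)
Definition input (R : realDomainType) (I : instance R) : store :=
  Store
    (fun x => match x with
              | 0 => Posz (npackets I)
              | 1 => Posz (nbuffers I)
              | _ => 0
              end)
    (fun a => match a with
              | 0 => table (@release R I)
              | 1 => table (@deadline R I)
              | 2 => table (fun p => Posz (@buffer R I p))
              | 3 => table (fun i => Posz (@capacity R I i))
              | _ => fun=> 0
              end).

Definition input_values (R : realDomainType) (I : instance R) : int -> R :=
  table (@value R I).

(* On halting, cell p of array 4 is nonzero iff packet p is accepted, in which
   case p stays in its buffer until it is sent, in the step given by cell p of
   array 5; all other packets are dropped on arrival.  The number of time steps
   is not bounded in terms of the number of packets, so a schedule cannot be
   output step by step. *)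
Definition output (R : realDomainType) (I : instance R) (s : store)
    : schedule (npackets I) :=
  let accepted (p : 'I_(npackets I)) := arr s 4 (Posz p) != 0 in
  let time (p : 'I_(npackets I)) := arr s 5 (Posz p) in
  Schedule
    (fun t => [set p | accepted p && (release p <= t <= time p)])
    (fun p => if accepted p then Some (time p) else None).

(* Main.v *)
(* Sort the packets by release time.  A set A of packets can be sent by the
   deadline iff Hall's condition holds: for all k <= l, the packets of A between
   the k-th and the l-th one that do not fit into their buffers upon the arrival
   of the l-th one, that is, \sum_i (#|A_i| - B_i) with truncated subtraction, can
   be sent in the steps between these two arrivals, and all packets from the k-th
   one on can be sent between its arrival and the deadline.  Necessity is a
   counting argument; for sufficiency, whenever a packet arrives at a full buffer,
   the head of that buffer is sent in the earliest free slot after its release,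
   and the remaining packets are treated likewise in the end.

   The overflow is a supermodular function of intervals, so that the sets
   satisfying Hall's condition are the independent sets of a matroid.  The packets
   are inserted from the last one to the first one, keeping an optimal set.  If
   the new packet k violates the condition, only intervals starting at k can be
   violated, and the first violated one exhibits the circuit in linear time: the
   packets up to l whose buffers overflow.  The cheapest packet of the circuit is
   dropped.  All phases take quadratic time. *)
Require Import Defs.
From mathcomp Require Import all_boot all_order all_algebra zify.

Set Implicit Arguments.
Unset Strict Implicit.
Unset Printing Implicit Defensive.

Import Order.TTheory GRing.Theory Num.Theory.
Local Open Scope ring_scope.

(** * Hall's condition *)

(** Truncated subtraction is convex: as [x + y <= u + v] with [v <= x, y <= u], spreading the
    cardinalities apart cannot decrease the sum, and pairing the larger capacity [c] with the
    smaller cardinality [v] favours the right-hand side. *)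
Lemma truncated_supermodular x y s u v c d : (d <= c)%N -> (v <= x)%N -> (v <= y)%N ->
  (x <= u)%N -> (y <= u)%N -> (s <= u)%N -> (s + v = x + y)%N ->
  (x - c + (y - d) <= u - d + (v - c))%N.
Proof. lia. Qed.

Section Windows.

Variables (n m : nat) (buf : 'I_n -> 'I_m) (B : 'I_m -> nat) (T : nat -> int).
Hypothesis T_mono : forall k l, (k <= l <= n)%N -> T k <= T l.

Implicit Types (A C S X Y Z : {set 'I_n}) (i : 'I_m) (e f j p q : 'I_n) (k l : nat).

Definition window A i k l : {set 'I_n} :=
  [set j in A | [&& buf j == i, (k <= j)%N & (j <= l)%N]].

(* Windows ending at n extend to the deadline, when the buffers must be empty. *)
Definition cap l i : nat := if (l < n)%N then B i else 0.

Definition overflow A k l : nat := (\sum_i (#|window A i k l| - cap l i))%N.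

Definition fits A k l : bool := (overflow A k l)%:Z <= T l - T k.

Definition hall A : Prop := forall k l, (k <= l <= n)%N -> fits A k l.

Lemma in_window A i k l j :
  (j \in window A i k l) = [&& j \in A, buf j == i, (k <= j)%N & (j <= l)%N].
Proof. by rewrite inE. Qed.

Lemma windowS A A' i k l k' l' :
  A \subset A' -> (k' <= k)%N -> (l <= l')%N ->
  window A i k l \subset window A' i k' l'.
Proof.
move=> /subsetP sA kk ll; apply/subsetP=> j; rewrite !in_window.
by case/and4P=> /sA -> -> /(leq_trans kk) -> /leq_trans ->.
Qed.

Lemma cap_le l l' i : (l <= l')%N -> (cap l' i <= cap l i)%N.
Proof. by rewrite /cap; case: ifP => //; case: ifP => //; lia. Qed.

Lemma overflow_subset A A' k l : A \subset A' -> (overflow A k l <= overflow A' k l)%N.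
Proof.
move=> sA; apply: leq_sum => i _; apply: leq_sub2r.
exact/subset_leq_card/windowS.
Qed.

Lemma hallS A A' : A \subset A' -> hall A' -> hall A.
Proof.
move=> sA hA k l kl; have := hA k l kl; rewrite /fits; have := overflow_subset k l sA.
lia.
Qed.

Lemma hall0 : hall set0.
Proof.
move=> k l kl; rewrite /fits /overflow big1 ?subr_ge0 ?T_mono // => i _.
by rewrite (_ : window _ _ _ _ = set0) ?cards0 //; apply/setP=> j; rewrite !inE.
Qed.

(** The inequality holds buffer by buffer. The capacity of a window depends on its right end alone,
    so hull and intersection carry the same two capacities. Disjoint windows may leave a gap, hence
    the hull only contains the union. *)
Lemma overflow_supermodular A k l k' l' :
  (overflow A k l + overflow A k' l' <=
   overflow A (minn k k') (maxn l l') + overflow A (maxn k k') (minn l l'))%N.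
Proof.
rewrite /overflow -!big_split /=; apply: leq_sum => i _.
have cUI := cardsUI (window A i k l) (window A i k' l').
have wI : window A i k l :&: window A i k' l' = window A i (maxn k k') (minn l l').
  apply/setP=> j; rewrite !inE geq_max leq_min.
  by case: (j \in A); case: (buf j == i); rewrite ?andbF //=; lia.
rewrite {}wI in cUI.
have uS : window A i k l :|: window A i k' l' \subset
          window A i (minn k k') (maxn l l').
  by rewrite subUset !windowS ?geq_minl ?geq_minr ?leq_maxl ?leq_maxr.
have le3 := subset_leq_card uS.
have le4 := subset_leq_card (subset_trans (subsetUl _ _) uS).
have le5 := subset_leq_card (subset_trans (subsetUr _ _) uS).
have le2 : (#|window A i (maxn k k') (minn l l')| <= #|window A i k l|)%N.
  by rewrite subset_leq_card // windowS ?leq_maxl ?geq_minl.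
have le1 : (#|window A i (maxn k k') (minn l l')| <= #|window A i k' l'|)%N.
  by rewrite subset_leq_card // windowS ?leq_maxr ?geq_minr.
have [ll|/ltnW ll] := leqP l l'; have cc := cap_le i ll.
  rewrite (maxn_idPr ll) (minn_idPl ll) in cUI le1 le2 le3 le4 le5 *.
  exact: (@truncated_supermodular _ _ #|window A i k l :|: window A i k' l'|).
rewrite (maxn_idPl ll) (minn_idPr ll) in cUI le1 le2 le3 le4 le5 *.
rewrite addnC; apply: (@truncated_supermodular _ _ #|window A i k l :|: window A i k' l'|) => //.
by rewrite cUI addnC.
Qed.

Lemma card_windowU1 A e i k l : e \notin A ->
  #|window (e |: A) i k l| =
  ([&& buf e == i, (k <= e)%N & (e <= l)%N] + #|window A i k l|)%N.
Proof.
move=> eA; have [e_in|/negPf e_out] := boolP [&& buf e == i, (k <= e)%N & (e <= l)%N].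
  have -> : window (e |: A) i k l = e |: window A i k l.
    apply/setP=> j; rewrite !inE; case: eqP => [->|] //=.
  by rewrite cardsU1 in_window (negPf eA).
rewrite add0n; congr #|pred_of_set _|; apply/setP=> j; rewrite !inE.
by case: eqP => [->|] //=; rewrite e_out andbF.
Qed.

Lemma overflowU1 A e k l : e \notin A ->
  overflow (e |: A) k l =
  (overflow A k l + ((k <= e <= l)%N && (cap l (buf e) <= #|window A (buf e) k l|)%N))%N.
Proof.
move=> eA; rewrite /overflow [LHS](bigD1 (buf e)) //= [in RHS](bigD1 (buf e)) //=.
rewrite (eq_bigr (fun i => #|window A i k l| - cap l i)%N) => [|i].
  by rewrite card_windowU1 // eqxx /=; case: (k <= e <= l)%N => /=; lia.
by rewrite eq_sym card_windowU1 // => /negPf->.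
Qed.

Lemma window_le_overflow A k l i : (#|window A i k l| - cap l i <= overflow A k l)%N.
Proof. by rewrite /overflow (bigD1 i) //= leq_addr. Qed.

(** * Circuits exhibited by violated windows *)

Definition circuit A k l : {set 'I_n} :=
  [set j in A | [&& (k <= j)%N, (j <= l)%N &
                    (cap l (buf j) < #|window A (buf j) k l|)%N]].

(** Removing the packets whose buffers do not overflow leaves the overflow of this window unchanged,
    so the window stays violated. *)
Lemma circuit_dep A k l : (k <= l <= n)%N -> ~~ fits A k l -> ~ hall (circuit A k l).
Proof.
move=> kl; rewrite /fits => viol /(_ k l kl); rewrite /fits; apply/negP.
suff -> : overflow (circuit A k l) k l = overflow A k l by [].
apply: eq_bigr => i _; have [le|lt] := leqP #|window A i k l| (cap l i).
  have : (#|window (circuit A k l) i k l| <= #|window A i k l|)%N.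
    by rewrite subset_leq_card // windowS //; apply/subsetP=> j; rewrite inE => /andP[].
  lia.
congr (#|pred_of_set _| - _)%N; apply/setP=> j; rewrite !inE.
by case: eqP => [->|] /=; rewrite ?andbF // lt; case: (j \in A); lia.
Qed.

Lemma mem_circuit A p k l : hall A -> (k <= l <= n)%N -> ~~ fits (p |: A) k l ->
  p \in circuit (p |: A) k l.
Proof.
move=> hA kl viol; apply/negPn/negP=> pC; apply: (circuit_dep kl viol).
apply: hallS hA; apply/subsetP=> j jC; move: (jC).
by rewrite inE !in_setU1 => /andP[/orP[/eqP jp|//]]; rewrite jp (negPf pC) in jC.
Qed.

Lemma overflowD1 A f k l : f \in A -> (k <= f <= l)%N ->
  (cap l (buf f) < #|window A (buf f) k l|)%N ->
  (overflow (A :\ f) k l < overflow A k l)%N.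
Proof.
move=> fA kfl lt.
have fN : f \notin A :\ f by rewrite !inE eqxx.
rewrite -{2}(setD1K fA) overflowU1 // kfl /=.
by move: lt; rewrite -{1}(setD1K fA) card_windowU1 // eqxx kfl /= add1n ltnS => ->; rewrite addn1.
Qed.

(** Adding [e] raises each overflow by at most one, so a violated window exceeds its slots by
    exactly one. It includes the window from [k] to [l]; growing a window adds packets and moving
    its right end forward never raises capacities, so the buffer of [f] overflows there as well and
    removing [f] repairs it. *)
Lemma hall_remove X e k l f : hall X -> (k <= l <= n)%N ->
  (forall k' l', (k' <= e <= l')%N -> (l' <= n)%N -> ~~ fits (e |: X) k' l' ->
    (k' <= k)%N /\ (l <= l')%N) ->
  f \in circuit (e |: X) k l -> hall ((e |: X) :\ f).
Proof.
move=> hX kl inner; rewrite inE => /andP[fA /and3P[kf fl lt]] k' l' kl'.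
have [eX|eX] := boolP (e \in X).
  by apply: (hallS _ hX kl'); rewrite (setUidPr _) ?sub1set // subsetDl.
have sub := @overflow_subset ((e |: X) :\ f) (e |: X) k' l' (subsetDl _ _).
have := hX k' l' kl'; have := overflowU1 k' l' eX; rewrite /fits => ov hXw.
have [kel|/negPf kel] := boolP (k' <= e <= l')%N; last first.
  by rewrite kel addn0 in ov; lia.
have [ok|viol] := boolP (fits (e |: X) k' l').
  by move: ok; rewrite /fits; lia.
have [kk ll] : (k' <= k)%N /\ (l <= l')%N by apply: inner viol => //; lia.
have : (overflow ((e |: X) :\ f) k' l' < overflow (e |: X) k' l')%N.
  apply: overflowD1 => //; first by lia.
  apply: leq_ltn_trans (cap_le (buf f) ll) (leq_trans lt _).
  exact/subset_leq_card/windowS.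
move: ov; rewrite kel; case: (_ <= _)%N; lia.
Qed.

(* Two violated windows contain e, and by supermodularity so is their
   intersection: the smallest violated window lies in all others. *)
Lemma hall_circuit X e : hall X -> (exists k l, (k <= l <= n)%N /\ ~~ fits (e |: X) k l) ->
  exists C, [/\ C \subset e |: X, ~ hall C & forall f, f \in C -> hall ((e |: X) :\ f)].
Proof.
move=> hX [k0 [l0 [kl0 viol0]]].
have tight k l : (k <= l <= n)%N -> ~~ fits (e |: X) k l ->
    (k <= e <= l)%N /\ (overflow (e |: X) k l)%:Z = T l - T k + 1.
  move=> kl; have := hX k l kl; rewrite /fits.
  have [eX|eX] := boolP (e \in X).
    by rewrite (setUidPr _) ?sub1set //; lia.
  by rewrite (overflowU1 k l eX); case: (k <= e <= l)%N => /=; lia.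
have exw : exists d, [exists k : 'I_n.+1, [exists l : 'I_n.+1,
    [&& (k <= l)%N, ~~ fits (e |: X) k l & (l - k == d)%N]]].
  exists (l0 - k0)%N; apply/existsP.
  have lt1 : (k0 < n.+1)%N by lia.
  have lt2 : (l0 < n.+1)%N by lia.
  exists (Ordinal lt1); apply/existsP; exists (Ordinal lt2) => /=.
  by rewrite viol0 eqxx; lia.
case: (ex_minnP exw) => d /existsP[k /existsP[l /and3P[kl viol /eqP dE]]] dmin.
have ln : (l <= n)%N by rewrite -ltnS.
have kln : (k <= l <= n)%N by rewrite kl.
exists (circuit (e |: X) k l); split.
- by apply/subsetP=> j; rewrite inE => /andP[].
- exact: circuit_dep.
move=> f fC; apply: hall_remove fC => // k' l' kel' ln' viol'.
have kl' : (k' <= l' <= n)%N by lia.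
have [kel ovE] := tight _ _ kln viol; have [_ ovE'] := tight _ _ kl' viol'.
have := overflow_supermodular (e |: X) k l k' l'.
have kl1 : (minn k k' <= maxn l l' <= n)%N by lia.
have kl2 : (maxn k k' <= minn l l' <= n)%N by lia.
have TT : T (maxn l l') - T (minn k k') + (T (minn l l') - T (maxn k k')) =
          T l - T k + (T l' - T k').
  by rewrite /maxn /minn; case: (ltnP k k'); case: (ltnP l l'); lia.
(* If the intersection is violated too, minimality of [d] makes it equal to the smallest window. If
   it fits, supermodularity gives the hull an excess of at least two, whereas [tight] allows only
   one. *)
have [ok|viol1] := boolP (fits (e |: X) (maxn k k') (minn l l')); last first.
  have lt1 : (maxn k k' < n.+1)%N by lia.
  have lt2 : (minn l l' < n.+1)%N by lia.
  have := dmin (minn l l' - maxn k k')%N.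
  move=> /(_ _)H _; suff: (d <= minn l l' - maxn k k')%N by lia.
  apply: H; apply/existsP; exists (Ordinal lt1); apply/existsP; exists (Ordinal lt2) => /=.
  by rewrite viol1 eqxx; lia.
have [ok'|viol1] := boolP (fits (e |: X) (minn k k') (maxn l l')).
  by move: ok ok'; rewrite /fits; lia.
have [_] := tight _ _ kl1 viol1; move: ok; rewrite /fits; lia.
Qed.

(** * Matroid augmentation and exchange *)

Lemma hall_or_violated A : hall A \/ exists k l, (k <= l <= n)%N /\ ~~ fits A k l.
Proof.
have [/existsP[k /existsP[l /andP[kl viol]]]|none] :=
  boolP [exists k : 'I_n.+1, [exists l : 'I_n.+1, (k <= l)%N && ~~ fits A k l]].
  by right; exists k, l; rewrite kl -ltnS ltn_ord.
left=> k l /andP[kl ln].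
have lt1 : (k < n.+1)%N by lia.
have lt2 : (l < n.+1)%N by lia.
move: none; rewrite negb_exists => /forallP/(_ (Ordinal lt1)).
rewrite negb_exists => /forallP/(_ (Ordinal lt2)) /=.
by rewrite kl /= negbK.
Qed.

(** Induction on the size of [S :\: X]: an element [e] of it is added to [X], and if this violates
    Hall's condition, an element [f] of the resulting circuit outside [S] is removed. [X] does not
    shrink and moves closer to [S]. The only newcomer [e] lies in [S], so the packet finally found
    comes from the original [X]. *)
Lemma hall_augment S X : hall S -> hall X -> (#|S| < #|X|)%N ->
  exists2 x, x \in X :\: S & hall (x |: S).
Proof.
move=> hS; have [N] := ubnP #|S :\: X|; elim: N X => // N IH X leN hX lt.
have [SX|/subsetPn[e eS eX]] := boolP (S \subset X).
  have /set0Pn[x xXS] : X :\: S != set0.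
    rewrite -card_gt0; have := cardsD X S; rewrite (setIidPr SX).
    have := subset_leq_card SX; lia.
  exists x => //; apply: hallS hX; rewrite subUset SX sub1set.
  by case/setDP: xXS => ->.
have ltD (X' : {set 'I_n}) : e \in X' -> S :&: X \subset X' -> (#|S :\: X'| < N)%N.
  move=> eX' sX'; apply: leq_trans (_ : #|S :\: X| <= _)%N; last by lia.
  apply: proper_card; apply/properP; split; last first.
    by exists e; rewrite !inE ?eS ?eX ?eX'.
  apply/subsetP=> j; rewrite !inE => /andP[jX' jS]; rewrite jS andbT.
  by apply: contra jX' => jX; rewrite (subsetP sX') // inE jS.
have [heX|violated] := hall_or_violated (e |: X).
  case: (IH (e |: X)) => //.
  - by apply: ltD; rewrite ?setU11 // (subset_trans (subsetIr _ _)) ?subsetUr.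
  - by rewrite cardsU1 eX; lia.
  move=> x; rewrite inE => /andP[xS]; rewrite !inE => /orP[/eqP xe|xX].
    by rewrite xe eS in xS.
  by exists x => //; rewrite inE xS.
have [C [CeX nC remC]] := hall_circuit hX violated.
have /subsetPn[f fC fS] : ~~ (C \subset S).
  by apply/negP=> CS; apply: nC; apply: hallS hS.
have fe : f != e by apply: contraNneq fS => ->.
have fX : f \in X by have := subsetP CeX f fC; rewrite !inE (negPf fe).
case: (IH ((e |: X) :\ f)) => //.
- apply: ltD; first by rewrite !inE eq_sym fe eqxx.
  apply/subsetP=> j; rewrite !inE => /andP[jS ->]; rewrite orbT andbT.
  by apply: contraNneq fS => <-.
- exact: remC.
- have := cardsD1 f (e |: X); rewrite cardsU1 eX !inE fX orbT; lia.
move=> x; rewrite !inE => /and3P[xS xf /orP[/eqP xe|xX]].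
  by rewrite xe eS in xS.
by exists x => //; rewrite inE xS.
Qed.

Lemma hall_extend S X : hall S -> hall X ->
  exists Z, [/\ hall Z, S \subset Z, Z \subset S :|: X & (#|X| <= #|Z|)%N].
Proof.
move=> hS hX; have [N] := ubnP (#|X| - #|S|)%N; elim: N S hS => // N IH S hS leN.
have [le|lt] := leqP #|X| #|S|.
  by exists S; split; rewrite ?subsetUl.
have [x] := hall_augment hS hX lt; rewrite inE => /andP[xS xX] hxS.
have [|Z [hZ SZ ZSX le]] := IH _ hxS; first by rewrite cardsU1 xS; lia.
exists Z; split=> //; first exact: subset_trans (subsetUr _ _) SZ.
by apply: subset_trans ZSX _; rewrite -setUA subUset sub1set inE xX orbT subxx.
Qed.

(** [C :\ p] is extended by elements of [X] to a set [Z] at least as large as [X]. It avoids [p],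
    since otherwise it would contain [C]. Augmenting [X :\ p] from [Z] yields an element outside
    [X], hence one of [C]. *)
Lemma hall_exchange C X p : ~ hall C -> p \in C -> hall (C :\ p) -> hall X -> p \in X ->
  exists2 q, q \in C :\: X & hall (q |: X :\ p).
Proof.
move=> nC pC hCp hX pX; have [Z [hZ CZ ZCX le]] := hall_extend hCp hX.
have pZ : p \notin Z.
  apply/negP=> pZ; apply: nC; apply: hallS hZ.
  by rewrite -(setD1K pC) subUset sub1set pZ.
have hY : hall (X :\ p) by apply: hallS hX; apply: subsetDl.
have [|q] := hall_augment hY hZ; first by apply: leq_trans le; rewrite (cardsD1 p X) pX.
rewrite !inE negb_and negbK => /andP[qX qZ] hq; exists q => //.
have qp : q != p by apply: contraNneq pZ => <-.
move: qX; rewrite (negPf qp) /= => qX; rewrite inE qX.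
by have := subsetP ZCX q qZ; rewrite !inE (negPf qX) orbF => /andP[].
Qed.

Lemma overflow_from A p k l : {in A, forall j, (p <= j)%N} -> (k <= p)%N ->
  overflow A k l = overflow A p l.
Proof.
move=> Ap kp; apply: eq_bigr => i _; congr (#|pred_of_set _| - _)%N; apply/setP=> j.
rewrite !in_window; case jA: (j \in _) => //=.
by rewrite Ap // (leq_trans kp) ?Ap.
Qed.

(** Only windows containing [p] can become violated. As [p] is the first packet, a window starting
    earlier has the same overflow as the one starting at [p] and at least as many slots. *)
Lemma hallU1 A p : hall A -> p \notin A -> {in A, forall j, (p <= j)%N} ->
  (forall l, (p <= l <= n)%N -> fits (p |: A) p l) -> hall (p |: A).
Proof.
move=> hA pA Ap ok k l kl; have [kpl|/negPf out] := boolP (k <= p <= l)%N; last first.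
  by rewrite /fits overflowU1 // out addn0; apply: hA.
have [kp pl] := andP kpl; have := ok l; rewrite /fits (overflow_from l _ kp).
  have : T k <= T p by apply: T_mono; have := ltn_ord p; lia.
  lia.
by move=> j; rewrite !inE => /orP[/eqP->|/Ap].
Qed.

(** * Maintaining a heaviest set while earlier packets are inserted *)

Section Weights.

Variables (R : realDomainType) (w : 'I_n -> R).
Hypothesis w_ge0 : forall j, 0 <= w j.

Definition best (k : nat) A : Prop :=
  [/\ {in A, forall j, (k <= j)%N}, hall A &
      forall X, {in X, forall j, (k <= j)%N} -> hall X ->
        \sum_(j in X) w j <= \sum_(j in A) w j].

Lemma best_init : best n set0.
Proof.
split=> [j||X Xn _]; [by rewrite inE | exact: hall0 |].
rewrite big1 ?sumr_ge0 // => j /Xn; have := ltn_ord j; lia.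
Qed.

Lemma sum_setD1_le X p k A : best k.+1 A -> p = k :> nat -> hall X ->
  {in X, forall j, (k <= j)%N} -> \sum_(j in X :\ p) w j <= \sum_(j in A) w j.
Proof.
move=> [_ _ opt] pk hX Xk; apply: opt; last exact: hallS (subsetDl _ _) hX.
move=> j; rewrite !inE => /andP[jp jX]; rewrite ltn_neqAle Xk // andbT.
by apply: contra_neq jp => kj; apply: val_inj; rewrite /= -kj pk.
Qed.

Lemma best_accept p A : best p.+1 A -> hall (p |: A) -> best p (p |: A).
Proof.
move=> bA hpA; have [Ap hA opt] := bA; split=> // [j|X Xp hX].
  by rewrite !inE => /orP[/eqP->|/Ap/ltnW].
have pA : p \notin A by apply/negP=> /Ap; rewrite ltnn.
have le := sum_setD1_le bA erefl hX Xp.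
rewrite big_setU1 //=; have [pX|pX] := boolP (p \in X).
  by rewrite (big_setD1 p) //= lerD2l.
rewrite (_ : X :\ p = X) in le; first by rewrite (le_trans le) // lerDr.
by apply/setDidPl; rewrite disjoint_sym disjoints1.
Qed.

(** A competitor [X] without [p] weighs at most as much as [A], and [w q0 <= w p] since [p] lies in
    the circuit. If [X] contains [p], exchanging [p] for some [q] of the circuit gives a competitor
    of [A], and [w q0 <= w q]. *)
Lemma best_replace p A k l q0 : best p.+1 A -> k = p :> nat -> (k <= l <= n)%N ->
  ~~ fits (p |: A) k l -> (forall l', (k <= l' < l)%N -> fits (p |: A) k l') ->
  q0 \in circuit (p |: A) k l ->
  {in circuit (p |: A) k l, forall q, w q0 <= w q} ->
  best p ((p |: A) :\ q0).
Proof.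
move=> bA -> {k} kl viol first q0C q0min; have [Ap hA opt] := bA.
have pA : p \notin A by apply/negP=> /Ap; rewrite ltnn.
set C := circuit _ _ _ in q0C q0min.
have nC : ~ hall C by exact: circuit_dep.
have CpA : C \subset p |: A by apply/subsetP=> j; rewrite inE => /andP[].
have pC : p \in C by exact: mem_circuit.
have hCp : hall (C :\ p).
  apply: hallS hA; apply/subsetP=> j; rewrite !inE => /andP[jp /andP[]].
  by rewrite (negPf jp).
have w_pA X : \sum_(j in X) w j <= \sum_(j in p |: A) w j - w q0 ->
    \sum_(j in X) w j <= \sum_(j in (p |: A) :\ q0) w j.
  by rewrite [\sum_(j in p |: A) w j](big_setD1 q0) ?(subsetP CpA) //= addrAC subrr add0r.
have pAp : {in p |: A, forall j, (p <= j)%N}.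
  by move=> j; rewrite !inE => /orP[/eqP->|/Ap/ltnW].
split=> [j /setD1P[_ /pAp] //||X Xp hX].
(* A violated window ending before [l] would make the window from [p] with the same end violated,
   contradicting that [l] is the first such end. *)
- apply: hall_remove q0C => // k' l' kel ln viol'; split; first by lia.
  case: leqP => // ll; have := first l'; rewrite ll; case/andP: kel => kp ->.
  move=> /(_ isT); move: viol'; rewrite /fits.
  rewrite (overflow_from l' pAp kp).
  have : T k' <= T p by apply: T_mono; have := ltn_ord p; lia.
  lia.
apply: w_pA; rewrite big_setU1 //=; have le := sum_setD1_le bA erefl hX Xp.
have [pX|pX] := boolP (p \in X); last first.
  rewrite (_ : X :\ p = X) in le.
    by apply: le_trans le _; rewrite addrAC lerDr subr_ge0 q0min.
  by apply/setDidPl; rewrite disjoint_sym disjoints1.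
have [q /setDP[qC qX] hq] := hall_exchange nC pC hCp hX pX.
have : \sum_(j in q |: X :\ p) w j <= \sum_(j in A) w j.
  apply: opt => // j; rewrite !inE => /orP[/eqP->|/andP[jp jX]].
    have := subsetP CpA q qC; rewrite !inE => /orP[/eqP qp|/Ap //].
    by rewrite qp pX in qX.
  rewrite ltn_neqAle Xp // andbT.
  by apply: contra_neq jp => pj; apply: val_inj.
rewrite big_setU1 /=; last by rewrite !inE (negPf qX) andbF.
move=> leq; rewrite (big_setD1 p) //= -addrA lerD2l lerBrDl.
by apply: le_trans leq; rewrite lerD2r q0min.
Qed.

End Weights.
End Windows.

(** * Sending every packet in the earliest free slot *)

Lemma card_belowS n (P : pred 'I_n) (j : 'I_n) :
  #|[set q in 'I_n | P q && (q < j.+1)%N]| = (#|[set q in 'I_n | P q && (q < j)%N]| + P j)%N.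
Proof.
have [Pj|/negPf Pj] := boolP (P j).
  have -> : [set q in 'I_n | P q && (q < j.+1)%N] = j |: [set q in 'I_n | P q && (q < j)%N].
    apply/setP=> q; rewrite !inE ltnS leq_eqVlt (inj_eq val_inj).
    by have [->|] := eqVneq q j; rewrite //= Pj.
  by rewrite cardsU1 !inE ltnn !andbF addnC.
rewrite addn0; apply: eq_card => q; rewrite !inE ltnS leq_eqVlt (inj_eq val_inj).
by have [->|] := eqVneq q j; rewrite //= Pj.
Qed.

Section Slots.

Variables (n m : nat) (buf : 'I_n -> 'I_m) (B : 'I_m -> nat) (T : nat -> int).
Hypothesis T_mono : forall k l, (k <= l <= n)%N -> T k <= T l.
Variable A : {set 'I_n}.
Hypothesis hallA : hall buf B T A.

Implicit Types (S : {set 'I_n}) (i : 'I_m) (h j q : 'I_n) (k l : nat).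
Implicit Types (time : 'I_n -> int) (x y : int).

Definition before (X : {set 'I_n}) i k : {set 'I_n} :=
  [set j in X | (buf j == i) && (j < k)%N].

Lemma window0 (X : {set 'I_n}) i k : window buf X i 0 k = before X i k.+1.
Proof. by apply/setP=> j; rewrite !inE. Qed.

Lemma card_by_buffer (X : {set 'I_n}) :
  #|X| = (\sum_i #|[set j in X | buf j == i]|)%N.
Proof.
rewrite -sum1_card (partition_big buf predT) //=; apply: eq_bigr => i _.
by rewrite -sum1_card; apply: eq_bigl => j; rewrite inE.
Qed.

Lemma card_beforeS (X : {set 'I_n}) i j :
  #|before X i j.+1| = (#|before X i j| + ((j \in X) && (buf j == i)))%N.
Proof.
have E k : before X i k = [set j in 'I_n | ((j \in X) && (buf j == i)) && (j < k)%N].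
  by apply/setP=> j'; rewrite !inE andbA.
by rewrite !E card_belowS.
Qed.

Lemma sum_beforeS (X : {set 'I_n}) j :
  (\sum_i (#|before X i j.+1| - B i) =
   \sum_i (#|before X i j| - B i) +
   ((j \in X) && (B (buf j) < #|before X (buf j) j.+1|)))%N.
Proof.
rewrite [LHS](bigD1 (buf j)) //= [in RHS](bigD1 (buf j)) //=.
rewrite (eq_bigr (fun i => #|before X i j| - B i)%N) => [|i ij]; last first.
  by rewrite card_beforeS eq_sym (negPf ij) andbF addn0.
by rewrite card_beforeS eqxx andbT; case: (j \in X) => /=; lia.
Qed.

Lemma window_before (X : {set 'I_n}) (p : 'I_n) i l : {in X, forall j, (p <= j)%N} ->
  window buf X i p l = before X i l.+1.
Proof.
by move=> Xp; apply/setP=> j; rewrite !inE; case jX: (j \in X); rewrite //= Xp.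
Qed.

Lemma overflow_before (X : {set 'I_n}) (p : 'I_n) l : {in X, forall j, (p <= j)%N} ->
  (l < n)%N -> overflow buf B X p l = (\sum_i (#|before X i l.+1| - B i))%N.
Proof.
by move=> Xp ln; apply: eq_bigr => i _; rewrite window_before // /cap ln.
Qed.

Lemma overflow_end (X : {set 'I_n}) (p : 'I_n) : {in X, forall j, (p <= j)%N} ->
  overflow buf B X p n = #|X|.
Proof.
move=> Xp; rewrite card_by_buffer; apply: eq_bigr => i _; rewrite /cap ltnn subn0.
apply: eq_card => j; rewrite !inE; case jX: (j \in X) => //=.
by rewrite Xp // (ltnW (ltn_ord j)) !andbT.
Qed.

Lemma card_window_split (X : {set 'I_n}) i k l : (k <= l)%N ->
  #|window buf X i 0 l| = (#|before X i k| + #|window buf X i k l|)%N.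
Proof.
move=> kl; rewrite -(cardsID [set j : 'I_n | (j < k)%N] (window buf X i 0 l)).
congr addn; apply: eq_card => j; rewrite !inE -?leqNgt.
  by case: (j \in X); case: (buf j == i); rewrite ?andbF //=; lia.
by case: (j \in X); case: (buf j == i); rewrite ?andbF //=; lia.
Qed.

(** A partial assignment in which every slot from the release of a packet up to its own is taken.
    This lets [slot_before] extend a run of busy slots to the left. *)
Record slots S time : Prop := Slots {
  slots_sub : S \subset A;
  slots_inj : {in S &, injective time};
  slots_ge : {in S, forall j, T j <= time j};
  slots_earliest : {in S, forall j y, T j <= y < time j ->
    exists2 j', j' \in S & time j' = y}
}.

Lemma card_busy S time x d :
  (forall y, x <= y < x + d%:Z -> exists2 j, j \in S & time j = y) -> (d <= #|S|)%N.
Proof.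
elim: d S => // d IH S busy; have [|j jS jx] := busy (x + d%:Z); first by lia.
rewrite (cardsD1 j) jS add1n ltnS; apply: IH => y yx.
have [|j' j'S j'y] := busy y; first by lia.
exists j' => //; rewrite !inE j'S andbT; apply/eqP=> jj; move: yx; rewrite -j'y jj jx; lia.
Qed.

(* Otherwise, let k be the first packet after whose release all slots before T l
   are taken.  The packets in these slots are k or later ones, since packets sit
   in the earliest free slot; with h, they are too many. *)
Lemma slot_before S time h x l : slots S time -> h \notin S -> (h <= l <= n)%N ->
  (forall y, T h <= y < x -> exists2 j, j \in S & time j = y) ->
  (forall k, (k <= l)%N ->
    (#|[set j in h |: S | (k <= j)%N]| <= overflow buf B A k l)%N) ->
  x < T l.
Proof.
move=> [_ _ _ early] hS hl busy few; rewrite ltNge; apply/negP=> lx.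
have full : forall y, T h <= y < T l -> exists2 j, j \in S & time j = y.
  by move=> y yh; apply: busy; lia.
have : exists k : nat, [/\ (k <= h)%N &
    forall y, T k <= y < T l -> exists2 j, j \in S & time j = y] by exists h.
case=> k; elim/ltn_ind: k => k IH [kh fullk].
have later j y : T k <= y < T l -> j \in S -> time j = y -> (k <= j)%N.
  move=> yk jS jy; rewrite leqNgt; apply/negP=> jk; apply: (IH j jk); split.
    by lia.
  move=> y' y'j; have [ky'|y'k] := leP (T k) y'; first by apply: fullk; lia.
  by apply: early jS _ _; lia.
have Tkl : T k <= T l by apply: T_mono; lia.
have sub : h |: [set j in S | (k <= j)%N] \subset [set j in h |: S | (k <= j)%N].
  apply/subsetP=> j; rewrite !inE => /orP[/eqP->|/andP[-> ->]]; last by rewrite orbT.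
  by rewrite eqxx.
have := leq_trans (subset_leq_card sub) (few k _).
rewrite cardsU1 inE (negPf hS) /=.
have : (`|T l - T k| <= #|[set j in S | (k <= j)%N]|)%N.
  apply: (@card_busy _ time (T k)) => y yk.
  have [|j jS jy] := fullk y; first by lia.
  by exists j => //; rewrite inE jS /=; apply: later jy => //; lia.
have kln : (k <= l <= n)%N by lia.
have /andP[kl _] := kln; move=> le1 /(_ kl) le2; have := hallA kln; rewrite /fits.
move: le1 le2; move: #|_|; lia.
Qed.

Lemma slots_add S time time' h x : slots S time -> h \in A -> h \notin S -> T h <= x ->
  (forall y, T h <= y < x -> exists2 j, j \in S & time j = y) ->
  {in S, forall j, time j <> x} -> time' h = x -> (forall j, j != h -> time' j = time j) ->
  slots (h |: S) time'.
Proof.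
move=> [sub inj ge early] hA hS hx busy free time'h time'E.
have time'S j : j \in S -> time' j = time j.
  by move=> jS; apply: time'E; apply: contraNneq hS => <-.
split.
- by rewrite subUset sub1set hA.
- move=> j j'; rewrite !inE => /orP[/eqP->|jS] /orP[/eqP->|j'S] //.
  + by rewrite time'h time'S // => xE; case: (free _ j'S).
  + by rewrite time'h time'S // => xE; case: (free _ jS).
  + by rewrite !time'S //; apply: inj.
- move=> j; rewrite !inE => /orP[/eqP->|jS]; first by rewrite time'h.
  by rewrite time'S // ge.
move=> j; rewrite !inE => /orP[/eqP->|jS] y.
  rewrite time'h => /busy[j' j'S jy]; exists j'; first by rewrite !inE j'S orbT.
  by rewrite time'S.
rewrite time'S // => /(early _ jS)[j' j'S jy]; exists j'; first by rewrite !inE j'S orbT.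
by rewrite time'S.
Qed.

(** Capacities vanish at the right end [n], where every packet counts as overflow. *)
Lemma card_from_le_overflow S k : S \subset A ->
  (#|[set j in S | (k <= j)%N]| <= overflow buf B A k n)%N.
Proof.
move=> sub; apply: leq_trans (overflow_subset _ _ _ _ sub); rewrite card_by_buffer.
apply: leq_sum => i _; rewrite /cap ltnn subn0; apply: subset_leq_card.
apply/subsetP=> j; rewrite !inE -andbA => /and3P[-> -> ->] /=.
exact: ltnW.
Qed.

(** * First-in-first-out service and buffer occupancy *)

Definition fifo S : Prop :=
  {in S & A, forall j' j, buf j = buf j' -> (j < j')%N -> j \in S}.

(** If [S] has a packet of buffer [i] from [k] on, then by [fifo] it has all packets of [A] in that
    buffer before [k]. Subtracting these from both sides of the count up to [l] leaves the truncated
    term of the window. This supplies the last hypothesis of [slot_before]. *)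
Lemma fifo_le_overflow S k l : S \subset A -> fifo S -> {in S, forall j, (j <= l)%N} ->
  (forall i, (#|[set j in S | buf j == i]| <= #|window buf A i 0 l| - cap n B l i)%N) ->
  (k <= l)%N -> (#|[set j in S | (k <= j)%N]| <= overflow buf B A k l)%N.
Proof.
move=> sub ff Sl count kl; rewrite card_by_buffer; apply: leq_sum => i _.
have -> : [set j in [set j in S | (k <= j)%N] | buf j == i] = window buf S i k l.
  apply/setP=> j; rewrite !inE; case jS: (j \in S) => //=.
  by rewrite (Sl j jS) andbT andbC.
have [->|[j]] := set_0Vmem (window buf S i k l); first by rewrite cards0.
rewrite in_window => /and4P[jS /eqP ji kj jl].
have := count i.
have -> : [set j in S | buf j == i] = window buf S i 0 l.
  apply/setP=> j'; rewrite !inE; case j'S: (j' \in S) => //=.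
  by rewrite (Sl j' j'S) andbT.
rewrite !(card_window_split _ _ kl).
have -> : before S i k = before A i k.
  apply/setP=> j'; rewrite !inE; case: eqP => [j'i|]; rewrite ?andbF //=.
  case: (ltnP j' k) => [j'k|]; rewrite ?andbF // !andbT.
  apply/idP/idP=> [/(subsetP sub) //|j'A]; apply: ff jS j'A _ _.
    by rewrite j'i.
  exact: leq_trans kj.
lia.
Qed.

(** The content of the buffer of [q] upon its arrival, [q] included. Packets without a slot count as
    present, so the set can only shrink when further packets receive slots. *)
Definition waiting S time q : {set 'I_n} :=
  [set j in A | [&& buf j == buf q, (j <= q)%N & ~~ ((j \in S) && (time j < T q))]].

Lemma waitingS S S' time time' q : S \subset S' -> {in S, time =1 time'} ->
  (#|waiting S' time' q| <= #|waiting S time q|)%N.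
Proof.
move=> SS' E; apply: subset_leq_card; apply/subsetP=> j; rewrite !inE.
case/and4P=> -> -> -> /=; apply: contra => /andP[jS jt].
by rewrite (subsetP SS') // -E.
Qed.

(** Invariant of the first sending phase. By [arrivals_count], each arrival beyond the first [B i]
    at buffer [i] has caused exactly one packet of that buffer to be sent. *)
Record arrivals k S time : Prop := Arrivals {
  arrivals_slots : slots S time;
  arrivals_fifo : fifo S;
  arrivals_lt : {in S, forall j, (j < k)%N};
  arrivals_count : forall i, #|[set j in S | buf j == i]| = (#|before A i k| - B i)%N;
  arrivals_time : {in S, forall j, time j < T k};
  arrivals_waiting : {in A, forall q, (q < k)%N ->
    (#|waiting S time q| <= B (buf q))%N}
}.

Lemma arrivals0 time : arrivals 0 set0 time.
Proof.
have in0 (P : 'I_n -> Prop) : {in (set0 : {set 'I_n}), forall j, P j}.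
  by move=> j; rewrite inE.
split=> //; first by split; rewrite ?sub0set // => j; rewrite inE.
- by move=> j j'; rewrite inE.
- move=> i; have -> : before A i 0 = set0 by apply/setP=> j; rewrite !inE !andbF.
  by rewrite cards0; apply: eq_card0 => j; rewrite !inE.
Qed.

Lemma arrivals_skip q S time : arrivals q S time -> q \notin A -> arrivals q.+1 S time.
Proof.
move=> [sl ff lt count early wait] qA; split=> //.
- by move=> j /lt /ltnW.
- by move=> i; rewrite card_beforeS (negPf qA) addn0.
- by move=> j /early jq; apply: lt_le_trans jq (T_mono _); have := ltn_ord q; lia.
move=> q' q'A; rewrite ltnS leq_eqVlt => /orP[/eqP/val_inj qq|]; last exact: wait.
by rewrite -qq q'A in qA.
Qed.

Lemma waiting_count q S time : S \subset A -> {in S, forall j, (j <= q)%N} ->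
  {in S, forall j, time j < T q} ->
  #|waiting S time q| = (#|before A (buf q) q.+1| - #|[set j in S | buf j == buf q]|)%N.
Proof.
move=> sub le early.
have SA : [set j in S | buf j == buf q] \subset before A (buf q) q.+1.
  apply/subsetP=> j; rewrite !inE => /andP[jS ->]; rewrite ltnS le //=.
  by rewrite (subsetP sub).
rewrite -(setIidPr SA) -cardsD; congr #|pred_of_set _|; apply/setP=> j; rewrite !inE ltnS.
have [jS|_] := boolP (j \in S) => /=.
  by rewrite early //=; case: (buf j == buf q); rewrite ?andbF.
by rewrite andbT.
Qed.

Lemma arrivals_keep q S time : arrivals q S time -> q \in A ->
  (#|before A (buf q) q.+1| <= B (buf q))%N -> arrivals q.+1 S time.
Proof.
move=> [sl ff lt count early wait] qA room; split=> //.
- by move=> j /lt /ltnW.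
- move=> i; rewrite count; have [qi|qi] := eqVneq (buf q) i; last first.
    by rewrite card_beforeS (negPf qi) andbF addn0.
  move: room; rewrite -qi card_beforeS; lia.
- by move=> j /early jq; apply: lt_le_trans jq (T_mono _); have := ltn_ord q; lia.
move=> q' q'A; rewrite ltnS leq_eqVlt => /orP[/eqP/val_inj->|]; last exact: wait.
by rewrite waiting_count ?(slots_sub sl) // => [|j /lt/ltnW //]; lia.
Qed.

Lemma arrivals_head q S time : arrivals q S time -> q \in A ->
  (B (buf q) < #|before A (buf q) q.+1|)%N ->
  exists j, [/\ j \in A, j \notin S, buf j = buf q & (j <= q)%N].
Proof.
move=> [sl ff lt count early wait] qA full.
have /subsetPn[j] : ~~ (before A (buf q) q.+1 \subset [set j in S | buf j == buf q]).
  apply/negP=> /subset_leq_card; rewrite count; have := full; rewrite card_beforeS.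
  case: (B (buf q)) => [|c]; last by lia.
  rewrite qA eqxx /=; lia.
by rewrite !inE ltnS => /and3P[jA /eqP jq jle]; rewrite jq eqxx andbT => jS; exists j.
Qed.

(** The head [h] must leave strictly before [q] arrives, which is where Hall's condition enters. *)
Lemma arrivals_eject q S time time' h x : arrivals q S time -> q \in A ->
  (B (buf q) < #|before A (buf q) q.+1|)%N ->
  h \in A -> h \notin S -> buf h = buf q ->
  {in A, forall j, buf j = buf q -> (j < h)%N -> j \in S} ->
  T h <= x ->
  (forall y, T h <= y < x -> exists2 j, j \in S & time j = y) ->
  {in S, forall j, time j <> x} -> time' h = x -> (forall j, j != h -> time' j = time j) ->
  arrivals q.+1 (h |: S) time'.
Proof.
move=> arr qA full hA hS hq head hx busy free time'h time'E.
have [sl ff lt count early wait] := arr.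
have hleq : (h <= q)%N.
  have [j [jA jS jq jle]] := arrivals_head arr qA full.
  by rewrite leqNgt; apply/negP=> qh; rewrite head // (leq_ltn_trans jle qh) in jS.
have sl' := slots_add sl hA hS hx busy free time'h time'E.
have ff' : fifo (h |: S).
  move=> j' j; rewrite !inE => /orP[/eqP->|j'S] jA jE jlt.
    by rewrite head ?orbT // -hq.
  by rewrite (ff j' j) ?orbT.
have le' : {in h |: S, forall j, (j <= q)%N}.
  by move=> j; rewrite !inE => /orP[/eqP->|/lt/ltnW].
have count' i : #|[set j in h |: S | buf j == i]| = (#|before A i q.+1| - B i)%N.
  have [qi|qi] := eqVneq (buf q) i; last first.
    rewrite card_beforeS (negPf qi) andbF addn0 -count; congr #|pred_of_set _|.
    by apply/setP=> j; rewrite !inE; case: eqP => [->|] //=; rewrite hq (negPf qi) andbF.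
  rewrite -qi; have -> : [set j in h |: S | buf j == buf q] = h |: [set j in S | buf j == buf q].
    by apply/setP=> j; rewrite !inE; case: eqP => [->|] //=; rewrite hq eqxx.
  by rewrite cardsU1 inE (negPf hS) /= count; move: full; rewrite card_beforeS qA eqxx; lia.
(* With [h] included, the packets sent from each buffer number exactly its excess up to [q], so
   [fifo_le_overflow] applies and [slot_before] can be used with [l = q]. *)
have xq : x < T q.
  apply: (slot_before sl hS) => //; first by have := ltn_ord q; lia.
  move=> k kq; apply: fifo_le_overflow => //; first exact: slots_sub sl'.
  by move=> i; rewrite count' window0 /cap ltn_ord.
have early' : {in h |: S, forall j, time' j < T q}.
  move=> j; rewrite !inE => /orP[/eqP->|jS]; first by rewrite time'h.
  by rewrite time'E ?early //; apply: contraNneq hS => <-.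
split=> //.
  by move=> j /early' jq; apply: lt_le_trans jq (T_mono _); have := ltn_ord q; lia.
move=> q' q'A; rewrite ltnS leq_eqVlt => /orP[/eqP/val_inj->|q'q].
  rewrite waiting_count ?(slots_sub sl') // count'; lia.
apply: leq_trans (wait _ q'A q'q); apply: waitingS; first exact: subsetUr.
by move=> j jS; rewrite time'E //; apply: contraNneq hS => <-.
Qed.

(** Invariant of the second sending phase: all arrivals have been accommodated, further sending only
    lowers the occupancy, and the remaining constraint is the end of time [T n]. *)
Record flushing k S time : Prop := Flushing {
  flushing_slots : slots S time;
  flushing_time : {in S, forall j, time j < T n};
  flushing_waiting : {in A, forall q, (#|waiting S time q| <= B (buf q))%N};
  flushing_served : {in A, forall j, (j < k)%N -> j \in S}
}.

Lemma flushing0 S time : arrivals n S time -> flushing 0 S time.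
Proof. by move=> [sl ff lt count early wait]; split=> // q qA; apply: wait. Qed.

Lemma flushing_skip h S time : flushing h S time -> ~~ ((h \in A) && (h \notin S)) ->
  flushing h.+1 S time.
Proof.
move=> [sl early wait served] hAS; split=> // j jA.
rewrite ltnS leq_eqVlt => /orP[/eqP/val_inj jh|]; last exact: served.
by move: hAS; rewrite -jh jA /= negbK.
Qed.

Lemma flushing_eject S time time' h x : flushing h S time -> h \in A -> h \notin S ->
  T h <= x ->
  (forall y, T h <= y < x -> exists2 j, j \in S & time j = y) ->
  {in S, forall j, time j <> x} -> time' h = x -> (forall j, j != h -> time' j = time j) ->
  flushing h.+1 (h |: S) time'.
Proof.
move=> [sl early wait served] hA hS hx busy free time'h time'E.
have sl' := slots_add sl hA hS hx busy free time'h time'E.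
have time'S j : j \in S -> time' j = time j.
  by move=> jS; apply: time'E; apply: contraNneq hS => <-.
split=> //.
- move=> j; rewrite !inE => /orP[/eqP->|jS]; last by rewrite time'S // early.
  rewrite time'h; apply: (slot_before sl hS) => //.
    by rewrite leqnn (ltnW (ltn_ord h)).
  by move=> k _; apply: card_from_le_overflow; exact: slots_sub sl'.
- move=> q qA; apply: leq_trans (wait q qA); apply: waitingS; first exact: subsetUr.
  by move=> j jS; rewrite time'S.
move=> j jA; rewrite ltnS leq_eqVlt => /orP[/eqP/val_inj->|jh]; first exact: setU11.
by rewrite setU1r // served.
Qed.

End Slots.

(** * Programs *)

(* Bounds the number of steps provided that no loop body is repeated more than n
   times in a row. *)
Fixpoint bound (n : nat) (c : cmd) : nat :=
  match c with
  | Skip => 1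
  | Assign _ e => (expr_cost e).+1
  | Put _ e1 e2 => (expr_cost e1 + expr_cost e2).+1
  | Seq c1 c2 => bound n c1 + bound n c2
  | If b c1 c2 => (test_cost b + (bound n c1 + bound n c2)).+1
  | While b c => n.+1 * (test_cost b + bound n c).+1
  end.

Fixpoint depth (c : cmd) : nat :=
  match c with
  | Seq c1 c2 | If _ c1 c2 => maxn (depth c1) (depth c2)
  | While _ c => (depth c).+1
  | _ => 0
  end.

(** Each level of loop nesting contributes one factor [n.+1], and [bound 0 c] is the bound with all
    these factors set to one. *)
Lemma bound_poly n d c : (depth c <= d)%N -> (bound n c <= n.+1 ^ d * bound 0 c)%N.
Proof.
elim: c d => [|x e|a e1 e2|c1 IH1 c2 IH2|b c1 IH1 c2 IH2|b c IH] d /=.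
- by rewrite muln1 expn_gt0.
- by move=> _; rewrite leq_pmull ?expn_gt0.
- by move=> _; rewrite leq_pmull ?expn_gt0.
- by rewrite geq_max => /andP[/IH1 h1 /IH2 h2]; rewrite mulnDr leq_add.
- rewrite geq_max => /andP[/IH1 h1 /IH2 h2]; have : (0 < n.+1 ^ d)%N by rewrite expn_gt0.
  by move: (n.+1 ^ d)%N h1 h2 => k; nia.
case: d => // d; rewrite ltnS => /IH h; rewrite mul1n expnS -mulnA leq_mul2l /=.
have : (0 < n.+1 ^ d)%N by rewrite expn_gt0.
by move: (n.+1 ^ d)%N h => k; nia.
Qed.

(** * Frames and rules for total correctness *)

Fixpoint writes_var (c : cmd) : seq nat :=
  match c with
  | Assign x _ => [:: x]
  | Seq c1 c2 | If _ c1 c2 => writes_var c1 ++ writes_var c2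
  | While _ c => writes_var c
  | _ => [::]
  end.

Fixpoint writes_arr (c : cmd) : seq nat :=
  match c with
  | Put a _ _ => [:: a]
  | Seq c1 c2 | If _ c1 c2 => writes_arr c1 ++ writes_arr c2
  | While _ c => writes_arr c
  | _ => [::]
  end.

Record frame (c : cmd) (s s' : store) : Prop := Frame {
  frame_var : forall x, x \notin writes_var c -> var s' x = var s x;
  frame_arr : forall a k, a \notin writes_arr c -> arr s' a k = arr s a k
}.

Section Runs.

Variables (R : realDomainType) (val : int -> R) (n : nat).

Lemma frame_refl c s : frame c s s. Proof. by []. Qed.

Lemma frame_trans c c' s s1 s2 : {subset writes_var c <= writes_var c'} ->
  {subset writes_arr c <= writes_arr c'} -> frame c' s s1 -> frame c s1 s2 -> frame c' s s2.
Proof.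
move=> vS aS [v1 a1] [v2 a2]; split=> [x|a k] h.
  by rewrite v2 ?v1 //; apply: contra h => /vS.
by rewrite a2 ?a1 //; apply: contra h => /aS.
Qed.

Lemma exec_frame c s t s' : exec val c s t s' -> frame c s s'.
Proof.
elim=> {c s t s'}; first by [].
- by move=> s x e; split=> // y; rewrite inE => /= /negPf->.
- by move=> s a e1 e2; split=> // b k; rewrite inE => /= /negPf->.
- move=> s s1 s2 c1 c2 _ _ _ f1 _ f2.
  apply: (@frame_trans c2 _ _ s1) => // [x|x|]; rewrite ?mem_cat; try by move=> ->; rewrite orbT.
  by apply: (@frame_trans c1 _ _ s) => // x; rewrite mem_cat => ->.
- move=> s s1 b c1 c2 _ _ f.
  by apply: (frame_trans _ _ _ f) => // x; rewrite mem_cat; case: (eval_test _ _ _) => -> //;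
     rewrite orbT.
- by [].
- move=> s s1 s2 b c _ _ _ _ f1 _ f2.
  by apply: frame_trans f2 => //; apply: frame_trans (frame_refl _ _) f1.
Qed.

(** Total correctness with the syntactic time bound built in, so that verifying a program in these
    rules yields its running time as well. *)
Definition runs (c : cmd) (s : store) (P : store -> Prop) : Prop :=
  exists t s', [/\ exec val c s t s', (t <= bound n c)%N & P s'].

Lemma runs_frame c s (P Q : store -> Prop) :
  runs c s Q -> (forall s', frame c s s' -> Q s' -> P s') -> runs c s P.
Proof.
move=> [t [s' [ex le Qs']]] H; exists t, s'; split=> //.
by apply: H => //; apply: exec_frame ex.
Qed.

Lemma runs_skip s (P : store -> Prop) : P s -> runs Skip s P.
Proof. by move=> Ps; exists 1%N, s; split=> //; constructor. Qed.

Lemma runs_assign s x e (P : store -> Prop) :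
  P (set_var s x (eval s e)) -> runs (Assign x e) s P.
Proof. by move=> Ps; do 2!eexists; split; [constructor | exact: leqnn | ]. Qed.

Lemma runs_put s a e1 e2 (P : store -> Prop) :
  P (set_arr s a (eval s e1) (eval s e2)) -> runs (Put a e1 e2) s P.
Proof. by move=> Ps; do 2!eexists; split; [constructor | exact: leqnn | ]. Qed.

Lemma runs_seq c1 c2 s (P : store -> Prop) :
  runs c1 s (fun s1 => runs c2 s1 P) -> runs (Seq c1 c2) s P.
Proof.
move=> [t1 [s1 [ex1 le1 [t2 [s2 [ex2 le2 Ps2]]]]]].
by exists (t1 + t2)%N, s2; split=> //=; [apply: exec_seq ex2 | apply: leq_add].
Qed.

Lemma runs_if b c1 c2 s (P : store -> Prop) :
  (eval_test val s b -> runs c1 s P) -> (~~ eval_test val s b -> runs c2 s P) ->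
  runs (If b c1 c2) s P.
Proof.
move=> H1 H2.
have [t [s' [ex le Ps']]] : exists t s',
    [/\ exec val (if eval_test val s b then c1 else c2) s t s',
        (t <= bound n c1 + bound n c2)%N & P s'].
  case: ifP => [/H1|/negbT/H2] [t [s' [ex le Ps']]]; exists t, s'; split=> //; lia.
by exists (test_cost b + t).+1, s'; split=> //=; [exact: exec_if | lia].
Qed.

Definition Lt (e1 e2 : expr) : test := Not (Le e2 e1).

(* Variable 0 holds n. *)
Definition For (x : nat) (c : cmd) : cmd :=
  Seq (Assign x (Const 0))
      (While (Lt (Var x) (Var 0)) (Seq c (Assign x (Plus (Var x) (Const 1))))).

(** The body writes neither the counter nor variable 0, so it is run exactly [n] times. Each step
    receives the frame from the start of the loop, so [Inv] need only describe what the loop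
    changes. *)
Lemma runs_for x c s (Inv : nat -> store -> Prop) (P : store -> Prop) :
  var s 0 = n -> [&& x != 0, 0 \notin writes_var c & x \notin writes_var c]%N ->
  (forall k s1 z, Inv k s1 -> Inv k (set_var s1 x z)) ->
  Inv 0 s ->
  (forall (j : 'I_n) s1, var s1 0 = n -> var s1 x = j -> frame (For x c) s s1 ->
     Inv j s1 -> runs c s1 (Inv j.+1)) ->
  (forall s1, frame (For x c) s s1 -> Inv n s1 -> P s1) ->
  runs (For x c) s P.
Proof.
move=> s0 /and3P[x0 c0 cx] stable Inv0 step post.
rewrite /For; set body := Seq c _; set loop := While _ body.
(* The number [d] of iterations left is the induction variable; [d.+1] includes the final failing
   test. *)
suff main d k s1 : (k + d = n)%N -> var s1 0 = n -> var s1 x = k ->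
    frame (Seq (Assign x (Const 0)) loop) s s1 -> Inv k s1 ->
    exists t s', [/\ exec val loop s1 t s',
      (t <= d.+1 * (test_cost (Lt (Var x) (Var 0)) + bound n body).+1)%N & P s'].
  apply: runs_seq; apply: runs_assign => /=; apply: (main n 0%N).
  - by [].
  - by rewrite /= eq_sym (negPf x0).
  - by rewrite /= eqxx.
  - split=> //= y; rewrite inE /= mem_cat inE => /norP[/negPf-> _] //.
  - exact: stable.
elim: d k s1 => [|d IH] k s1 kd v0 vx fr I1.
  exists (test_cost (Lt (Var x) (Var 0))).+1, s1; split.
  - by apply: exec_while_false; rewrite /= v0 vx; lia.
  - by rewrite mul1n; lia.
  - by apply: post => //; rewrite -kd addn0.
have kn : (k < n)%N by lia.
have [t [s2 [ex le I2]]] := step (Ordinal kn) s1 v0 vx fr I1.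
have fr2 := exec_frame ex.
have [t' [s3 [ex' le' Ps3]]] : exists t s', [/\ exec val loop (set_var s2 x k.+1) t s',
      (t <= d.+1 * (test_cost (Lt (Var x) (Var 0)) + bound n body).+1)%N & P s'].
  apply: (IH k.+1).
  - lia.
  - by rewrite /= eq_sym (negPf x0) (frame_var fr2) ?v0.
  - by rewrite /= eqxx.
  - apply: (frame_trans (c := body)) fr _ => [y yb|y //|].
      by rewrite /= inE yb orbT.
    split=> /= [y|a y]; rewrite ?cats0 ?mem_cat.
      by rewrite inE => /norP[yc /negPf->]; rewrite (frame_var fr2).
    by move=> ac; rewrite (frame_arr fr2).
  - exact: stable.
exists (test_cost (Lt (Var x) (Var 0)) +
  (t + (expr_cost (Plus (Var x) (Const 1))).+1) + t').+1, s3.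
split=> //.
- apply: (exec_while_true (s1 := set_var s2 x k.+1)) => //.
    by rewrite /= v0 vx; lia.
  apply: exec_seq ex _.
  have -> : k.+1 = eval s2 (Plus (Var x) (Const 1)) :> int.
    by rewrite /= (frame_var fr2) ?vx //; lia.
  exact: exec_assign.
- by move: le le'; rewrite /body /=; nia.
Qed.

End Runs.

(** * Packets in the order of release *)

Section Instance.

Variables (R : realDomainType) (I : instance R) (D : int).
Hypothesis deadlineE : forall p : 'I_(npackets I), deadline p = D.

Local Notation n := (npackets I).
Implicit Types (p q : 'I_n) (j : 'I_n) (X : {set 'I_n}).

(** Ties in release time are broken by index, which makes the order strict and total and [rank] a
    permutation. *)
Definition precedes q p : bool :=
  if (q < p)%N then release q <= release p else release q < release p.

Lemma precedes_irr p : precedes p p = false.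
Proof. by rewrite /precedes ltnn ltxx. Qed.

Lemma precedes_trans : transitive precedes.
Proof.
move=> q p r; rewrite /precedes.
by case: (ltnP p q); case: (ltnP q r); case: (ltnP p r); lia.
Qed.

Lemma precedes_total p q : p != q -> precedes p q || precedes q p.
Proof. by rewrite -(inj_eq val_inj) /precedes /=; case: (ltnP p q); case: (ltnP q p); lia. Qed.

Lemma precedes_release p q : precedes p q -> release p <= release q.
Proof. by rewrite /precedes; case: ifP => // _ /ltW. Qed.

Lemma rank_subproof p : (#|[set q | precedes q p]| < n)%N.
Proof.
rewrite -[X in (_ < X)%N]card_ord -cardsT; apply: proper_card; rewrite properT.
by apply/eqP=> /setP/(_ p); rewrite !inE precedes_irr.
Qed.

Definition rank p : 'I_n := Ordinal (rank_subproof p).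

Lemma rank_lt p q : precedes p q -> (rank p < rank q)%N.
Proof.
move=> pq; apply: proper_card; apply/properP; split.
  by apply/subsetP=> r; rewrite !inE => /precedes_trans; apply.
by exists p; rewrite inE ?precedes_irr.
Qed.

Lemma rank_inj : injective rank.
Proof.
by move=> p q pq; apply/eqP/negPn/negP=> /precedes_total/orP[] /rank_lt; rewrite pq ltnn.
Qed.

Definition packet : 'I_n -> 'I_n := invF rank_inj.

Lemma packetK : cancel packet rank. Proof. exact: f_invF. Qed.
Lemma rankK : cancel rank packet. Proof. exact: invF_f. Qed.
Lemma packet_inj : injective packet. Proof. exact: can_inj packetK. Qed.

Lemma release_packet j j' : (j <= j')%N -> release (packet j) <= release (packet j').
Proof.
rewrite leq_eqVlt => /orP[/eqP/val_inj-> //|jj].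
have : packet j != packet j' by rewrite (inj_eq packet_inj) -(inj_eq val_inj) neq_ltn jj.
case/precedes_total/orP=> [/precedes_release //|/rank_lt].
by rewrite !packetK ltnNge (ltnW jj).
Qed.

(* Late packets are moved to the first step after the deadline, which is also the
   end of time; there they overflow, so that none of them is accepted. *)
Definition clock (k : nat) : int :=
  if insub k is Some j then Num.min (release (packet j)) (D + 1) else D + 1.

Lemma clock_ord j : clock j = Num.min (release (packet j)) (D + 1).
Proof. by rewrite /clock valK. Qed.

Lemma clock_end : clock n = D + 1.
Proof. by rewrite /clock insubF ?ltnn. Qed.

Lemma clock_mono k l : (k <= l <= n)%N -> clock k <= clock l.
Proof.
case/andP=> kl _; rewrite /clock; case: (insubP _ l) => [j' _ /= j'l|ln]; last first.
  by case: insubP => // j _ _; rewrite ge_min lexx orbT.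
case: insubP => [j _ /= jk|]; last by have := ltn_ord j'; lia.
have : release (packet j) <= release (packet j') by apply: release_packet; lia.
by rewrite le_min !ge_min => ->; rewrite lexx orbT.
Qed.

Definition bufferof j := buffer (packet j).

Definition weight j : R := value (packet j).

(** For a late packet [j], the window from [j] to [n] has no slots, but capacity 0 there makes [j]
    itself overflow. *)
Lemma clock_release (A : {set 'I_n}) : hall bufferof (@capacity R I) clock A ->
  {in A, forall j, clock j = release (packet j)}.
Proof.
move=> hA j jA; have := hA j n; rewrite leqnn (ltnW (ltn_ord j)) => /(_ isT).
rewrite /fits clock_end clock_ord.
have := window_le_overflow bufferof (@capacity R I) A j n (bufferof j).
rewrite /cap ltnn subn0.
have : (0 < #|window bufferof A (bufferof j) j n|)%N.
  by apply/card_gt0P; exists j; rewrite in_window jA eqxx leqnn (ltnW (ltn_ord j)).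
lia.
Qed.

(** * Necessity of Hall's condition *)

Section Feasible.

Variable S : schedule n.
Hypothesis feasS : feasible S.

Lemma sent_content p t t' : send S p = Some t -> release p <= t' <= t -> p \in content S t'.
Proof.
move=> sp; have [d] := ubnP `|t - t'|%N; elim: d t' => // d IH t' dlt tt.
have [->|ne] := eqVneq t' t; first exact: feasible_pending feasS _ _ sp.
have pt : p \in content S (t' + 1) by apply: IH; lia.
by have [|] := feasible_resident feasS pt; rewrite ?addrK //; lia.
Qed.

Definition served : {set 'I_n} := [set j | on_time S (packet j)].

Definition sent_at j : int := odflt 0 (send S (packet j)).

Lemma servedP j : j \in served ->
  send S (packet j) = Some (sent_at j) /\ release (packet j) <= sent_at j <= D.
Proof.
rewrite inE /on_time /sent_at; case sj: send => [t|//]; rewrite deadlineE /= => tD.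
by rewrite (feasible_released feasS (feasible_pending feasS sj)) tD.
Qed.

Lemma served_inj : {in served &, injective sent_at}.
Proof.
move=> j j' /servedP[sj _] /servedP[sj' _] E; apply: packet_inj.
by apply: feasible_one_send feasS _ _ _ sj _; rewrite E.
Qed.

Lemma card_slots X x y : {in X &, injective sent_at} ->
  {in X, forall j, x <= sent_at j < y} -> (#|X| <= `|y - x|)%N.
Proof.
move=> inj Xxy; have [->|[j0 j0X]] := set_0Vmem X; first by rewrite cards0.
have d0 : (0 < `|y - x|)%N by have := Xxy _ j0X; lia.
pose f j : 'I_(`|y - x|.-1.+1) := inord `|sent_at j - x|.
rewrite -(prednK d0) -[leqRHS]card_ord -(card_in_imset (f := f) (D := mem X)) ?max_card //.
move=> j j' jX j'X; have := Xxy _ jX; have := Xxy _ j'X => xy xy'.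
move/(congr1 val); rewrite /= !inordK; [|lia..]; move=> E.
by apply: inj => //; lia.
Qed.

(** Served packets of the window that are sent before [clock l] occupy distinct slots from [clock k]
    on. The others are all in their buffers at time [clock l], so each buffer holds at most its
    capacity of them. *)
Lemma hall_served : hall bufferof (@capacity R I) clock served.
Proof.
move=> k l /andP[kl ln]; rewrite /fits.
pose early := [set j in served | (k <= j <= l)%N && (sent_at j < clock l)].
have Tkl : clock k <= clock l by apply: clock_mono; rewrite kl.
have : (#|early| <= `|clock l - clock k|)%N.
  have earlyS : {subset early <= served} by move=> j; rewrite inE => /andP[].
  apply: card_slots (sub_in2 earlyS served_inj) _ => j.
  rewrite inE => /andP[js /andP[/andP[kj _] ->]]; rewrite andbT.
  have [_ /andP[rj _]] := servedP js.
  have : clock k <= clock j by apply: clock_mono; have := ltn_ord j; lia.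
  by rewrite clock_ord; lia.
suff : (overflow bufferof (@capacity R I) served k l <= #|early|)%N by lia.
rewrite (card_by_buffer bufferof); apply: leq_sum => i _.
rewrite leq_subLR -(cardsID early (window _ _ _ _ _)) addnC leq_add //; last first.
  by apply/subset_leq_card/subsetP=> j; rewrite !inE => /andP[/and4P[_ ji _ _] ->].
have late j : j \in window bufferof served i k l :\: early ->
  [/\ buffer (packet j) = i, send S (packet j) = Some (sent_at j), (j <= l)%N,
      sent_at j <= D & clock l <= sent_at j].
  rewrite !in_setD in_window => /andP[+ /and4P[js /eqP ji kj jl]].
  have [sj /andP[rj jD]] := servedP js.
  by rewrite inE js kj jl /= -leNgt.
have [->|[j0 /late[_ _ _ j0D lj0]]] := set_0Vmem (window bufferof served i k l :\: early).
  by rewrite cards0.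
(* At [l = n] nobody is late, since served packets are sent by [D] and [clock n] is [D + 1]. *)
have lltn : (l < n)%N.
  by rewrite ltn_neqAle ln andbT; apply/eqP=> lE; move: lj0; rewrite lE clock_end; lia.
rewrite /cap lltn.
(* A late packet is still sent by [D], so [clock l] is not cut off and equals a true release time,
   by which all packets of the window have arrived. *)
pose jl := Ordinal lltn; have clE : clock l = release (packet jl).
  by have := clock_ord jl; rewrite /= => E; move: lj0; rewrite E; lia.
apply: leq_trans (feasible_capacity feasS (clock l) i).
rewrite -(card_imset _ packet_inj); apply/subset_leq_card/subsetP=> p /imsetP[j jW ->].
have [ji sj jlel _ lj] := late j jW.
rewrite inE ji eqxx andbT; apply: sent_content sj _; rewrite lj clE andbT.
exact: release_packet.
Qed.

Lemma total_value_served : total_value S = \sum_(j in served) weight j.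
Proof.
rewrite /total_value (reindex_inj packet_inj) /=.
by apply: eq_bigl => j; rewrite inE.
Qed.

End Feasible.

(** Every feasible schedule serves a set satisfying Hall's condition, so the heaviest such set
    bounds its value; the output serves exactly this set. *)
Lemma optimal_output (s : store) (A : {set 'I_n}) (time : 'I_n -> int) :
  best bufferof (@capacity R I) clock weight 0 A ->
  (forall j, arr s 4 (packet j : nat) = (j \in A)) ->
  (forall j, arr s 5 (packet j : nat) = time j) ->
  flushing bufferof (@capacity R I) clock A n A time ->
  optimal (output I s).
Proof.
move=> [_ hA opt] accE timeE [[_ inj ge _] timeD wait _].
have rel := clock_release hA.
have acc p : (arr s 4 (p : nat) != 0) = (rank p \in A).
  by rewrite -[p in LHS]rankK accE; case: (_ \in A).
have tm p : arr s 5 (p : nat) = time (rank p) by rewrite -[p in LHS]rankK timeE.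
have ge' p : rank p \in A -> release p <= time (rank p).
  by move=> pA; rewrite -{1}(rankK p) -rel // ge.
have sendE p t : send (output I s) p = Some t -> rank p \in A /\ time (rank p) = t.
  by rewrite /= acc; case: ifP => // pA [<-]; rewrite tm.
have contE p t : (p \in content (output I s) t) =
    (rank p \in A) && (release p <= t <= time (rank p)).
  by rewrite inE acc tm.
have feas : feasible (output I s).
  split.
  - by move=> t p; rewrite contE => /and3P[].
  - move=> t p; rewrite !contE => /and3P[pA rt tp] rlt; rewrite pA; split; first by lia.
    by move=> /sendE[_]; lia.
  - move=> t i; have [->|[p0]] := set_0Vmem [set p in content (output I s) t | buffer p == i].
      by rewrite cards0.
    rewrite inE contE => /andP[/and3P[p0A p0t _] /eqP p0i].
    pose P j := [&& j \in A, bufferof j == i & clock j <= t].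
    have P0 : P (rank p0) by rewrite /P p0A /bufferof rel // rankK p0i eqxx p0t.
    (* Occupancy rises only at arrivals: whatever buffer [i] holds at time [t] was already waiting
       when its last accepted packet released by [t] arrived. *)
    case: (arg_maxnP (fun j : 'I_n => j : nat) P0) => q /and3P[qA /eqP qi qt] qmax.
    apply: leq_trans (_ : #|waiting bufferof clock A A time q| <= _)%N; last first.
      by rewrite -qi; apply: wait.
    rewrite -(card_imset _ rank_inj); apply/subset_leq_card/subsetP=> j /imsetP[p].
    rewrite !inE acc tm => /andP[/and3P[pA rp tp] /eqP pi] ->.
    rewrite pA /= {1}/bufferof rankK pi qi eqxx -leNgt (le_trans qt tp) andbT /=.
    by apply: (qmax (rank p)); rewrite /P pA /bufferof rankK pi eqxx rel // rankK.
  - by move=> t p /sendE[pA <-]; rewrite contE pA lexx ge'.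
  - by move=> t p q /sendE[pA <-] /sendE[qA] /(inj _ _ qA pA)/rank_inj.
split=> // S' feasS'; rewrite !total_value_served.
have -> : served (output I s) = A.
  apply/setP=> j; rewrite inE /on_time /= acc packetK tm packetK; case: ifP => // jA.
  by rewrite deadlineE; have := timeD _ jA; rewrite clock_end; lia.
by apply: opt => //; exact: hall_served.
Qed.

End Instance.

(** * The algorithm *)

Infix ";;" := Seq (at level 61, right associativity).

(* Positions in the order of release index the arrays 6 (packet), 7 (clock) and
   10 (sent); 8 counts the packets of a buffer, and 9 marks the slots in use.
   Variables 2 and 3 are loop counters, 4 is the position being selected, 5 and 6
   are the overflow and the number of packets scanned, 7 is the end of the first
   violated window, 8 is the packet to drop or to send, and 9 its slot. *)
Definition Packet x : expr := Get 6 (Var x).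
Definition Clock x : expr := Get 7 (Var x).
Definition Buffer x : expr := Get 2 (Packet x).
Definition Capacity x : expr := Get 3 (Buffer x).
Definition Count x : expr := Get 8 (Buffer x).
Definition Accepted x : test := Lt (Const 0) (Get 4 (Packet x)).
Definition Sent x : test := Lt (Const 0) (Get 10 (Var x)).
Definition Increment x : cmd := Assign x (Plus (Var x) (Const 1)).
Definition CountPacket x : cmd := Put 8 (Buffer x) (Plus (Count x) (Const 1)).

(** Variable 10 receives the rank of the packet in variable 2, so sorting amounts to counting
    predecessors. *)
Definition count_preceding : cmd :=
  Assign 10 (Const 0) ;;
  For 3
    (If (Lt (Var 3) (Var 2))
       (If (Le (Get 0 (Var 3)) (Get 0 (Var 2))) (Increment 10) Skip)
       (If (Lt (Get 0 (Var 3)) (Get 0 (Var 2))) (Increment 10) Skip)).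

Definition sort_packets : cmd :=
  For 2
    (count_preceding ;;
     Put 6 (Var 10) (Var 2) ;;
     If (Le (Get 0 (Var 2)) (Get 1 (Var 2)))
       (Put 7 (Var 10) (Get 0 (Var 2)))
       (Put 7 (Var 10) (Plus (Get 1 (Var 2)) (Const 1)))) ;;
  Put 7 (Var 0) (Plus (Get 1 (Const 0)) (Const 1)).

(** Looping over packets instead of buffers keeps the cost independent of the number of buffers;
    only counters of buffers designated by some packet are ever read. *)
Definition reset_counts : cmd := For 3 (Put 8 (Buffer 3) (Const 0)).

(** Variable 7 equal to [n] means that no violation has been found; afterwards the guard turns the
    remaining iterations into no-ops, freezing the counters at the violated window. The window
    ending at [n] is tested in [select_packet] through variable 6. *)
Definition scan : cmd :=
  For 3
    (If (And (Le (Var 4) (Var 3)) (Le (Var 0) (Var 7)))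
       (If (Accepted 3)
          (CountPacket 3 ;; Increment 6 ;;
           If (Lt (Capacity 3) (Count 3)) (Increment 5) Skip) Skip ;;
        If (Lt (Minus (Clock 3) (Clock 4)) (Var 5)) (Assign 7 (Var 3)) Skip)
       Skip).

(** The capacity test applies only when variable 7 is below [n]; for the window ending at [n] the
    circuit contains all accepted packets. *)
Definition find_cheapest : cmd :=
  For 3
    (If (And (Accepted 3)
        (And (Le (Var 3) (Var 7))
        (And (Not (And (Lt (Var 7) (Var 0)) (Le (Count 3) (Capacity 3))))
             (Not (LeValue (Packet 8) (Packet 3))))))
       (Assign 8 (Var 3)) Skip).

Definition select_packet : cmd :=
  Put 4 (Packet 4) (Const 1) ;;
  reset_counts ;;
  Assign 5 (Const 0) ;; Assign 6 (Const 0) ;; Assign 7 (Var 0) ;;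
  scan ;;
  If (And (Le (Var 0) (Var 7)) (Le (Var 6) (Minus (Clock 0) (Clock 4))))
    Skip
    (Assign 8 (Var 4) ;; find_cheapest ;; Put 4 (Packet 8) (Const 0)).

Definition select_packets : cmd :=
  For 2 (Assign 4 (Minus (Minus (Var 0) (Const 1)) (Var 2)) ;; select_packet).

Definition send_packet : cmd :=
  Assign 9 (Clock 8) ;;
  For 3 (If (Lt (Const 0) (Get 9 (Var 9))) (Increment 9) Skip) ;;
  Put 9 (Var 9) (Const 1) ;; Put 10 (Var 8) (Const 1) ;; Put 5 (Packet 8) (Var 9).

Definition find_head : cmd :=
  Assign 8 (Var 0) ;;
  For 3
    (If (And (Le (Var 0) (Var 8))
        (And (Accepted 3)
        (And (Not (Sent 3))
        (And (Le (Buffer 3) (Buffer 2)) (Le (Buffer 2) (Buffer 3))))))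
       (Assign 8 (Var 3)) Skip).

Definition send_overflowing : cmd :=
  For 2
    (If (Accepted 2)
       (CountPacket 2 ;;
        If (Lt (Capacity 2) (Count 2)) (find_head ;; send_packet) Skip)
       Skip).

Definition send_remaining : cmd :=
  For 2
    (If (And (Accepted 2) (Not (Sent 2))) (Assign 8 (Var 2) ;; send_packet) Skip).

Definition program : cmd :=
  sort_packets ;; select_packets ;; reset_counts ;; send_overflowing ;; send_remaining.

Lemma table_ord (V : nmodType) n (f : 'I_n -> V) (j : 'I_n) : table f (j : nat) = f j.
Proof. by rewrite /table /= valK. Qed.

(** * Correctness of the phases *)

Section Correctness.

Variables (R : realDomainType) (I : instance R) (D : int).
Hypothesis deadlineE : forall p : 'I_(npackets I), deadline p = D.
Hypothesis first_deadline : table (@deadline R I) 0 = D.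

Local Notation n := (npackets I).
Local Notation buf := (@bufferof R I).
Local Notation B := (@capacity R I).
Local Notation T := (clock I D).
Local Notation runs := (runs (input_values I) n).
Implicit Types (s : store) (h j p q : 'I_n) (A S : {set 'I_n}).

Let T_mono := @clock_mono R I D.

Record ready s : Prop := Ready {
  ready_n : var s 0 = n;
  ready_packet : forall j, arr s 6 (j : nat) = packet j;
  ready_buffer : forall j, arr s 2 (packet j : nat) = buf j;
  ready_capacity : forall i : 'I_(nbuffers I), arr s 3 (i : nat) = B i;
  ready_clock : forall k, (k <= n)%N -> arr s 7 k = T k
}.

Lemma ready_frame c s s' : frame c s s' ->
  (0 \notin writes_var c)%N && all (fun a => a \notin writes_arr c) [:: 2; 3; 6; 7]%N ->
  ready s -> ready s'.
Proof.
move=> fr /andP[v0 /and5P[a2 a3 a6 a7 _]] [h0 h6 h2 h3 h7].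
by split=> *; rewrite ?(frame_var fr) ?(frame_arr fr) ?h7; auto.
Qed.

Lemma input_release p : arr (input I) 0 (p : nat) = release p.
Proof. exact: table_ord. Qed.

Lemma input_deadline p : arr (input I) 1 (p : nat) = D.
Proof. by rewrite -(deadlineE p); exact: table_ord. Qed.

Lemma runs_rank s p (P : store -> Prop) : var s 0 = n -> var s 2 = p ->
  (forall q, arr s 0 (q : nat) = release q) ->
  (forall s', frame count_preceding s s' -> var s' 10 = rank p -> P s') ->
  runs count_preceding s P.
Proof.
move=> s0 s2 s_rel post.
apply: (runs_frame (Q := fun s' => var s' 10 = rank p)); last by move=> s'; apply: post.
apply: runs_seq; apply: runs_assign; apply: (runs_for (Inv := fun k s' =>
  var s' 10 = #|[set q in 'I_n | precedes q p && (q < k)%N]|)) => //.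
- by rewrite /= eq_card0 // => q; rewrite !inE andbF.
- move=> q s1 s10 s13 fr Inv1.
  have rel q' : arr s1 0 (q' : nat) = release q' by rewrite (frame_arr fr) //= s_rel.
  have s12 : var s1 2 = p by rewrite (frame_var fr).
  apply: runs_if; rewrite /= s12 s13 => qp; apply: runs_if; rewrite /= s12 s13 !rel => le;
    [apply: runs_assign|apply: runs_skip|apply: runs_assign|apply: runs_skip];
    rewrite /= Inv1 card_belowS /precedes; case: ifP; lia.
move=> s1 fr Inv1; rewrite Inv1; congr Posz; apply: eq_card => q; rewrite !inE.
by rewrite ltn_ord andbT.
Qed.

Lemma runs_sort_packets (P : store -> Prop) :
  (forall s, ready s -> frame sort_packets (input I) s -> P s) ->
  runs sort_packets (input I) P.
Proof.
move=> post; apply: (runs_frame (Q := ready)); last by move=> s fr rd; apply: post.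
pose Inv k s := forall p, (p < k)%N ->
  arr s 6 (rank p : nat) = p /\ arr s 7 (rank p : nat) = Num.min (release p) (D + 1).
apply: runs_seq; apply: (runs_for (Inv := Inv)) => //.
  move=> p s1 s10 s12 fr1 Inv1.
  have rel q : arr s1 0 (q : nat) = release q by rewrite (frame_arr fr1) // input_release.
  have dl q : arr s1 1 (q : nat) = D by rewrite (frame_arr fr1) // input_deadline.
  apply: runs_seq; apply: (runs_rank s10 s12) => // s2 fr2 s2r.
  have {}rel q : arr s2 0 (q : nat) = release q by rewrite (frame_arr fr2).
  have {}dl q : arr s2 1 (q : nat) = D by rewrite (frame_arr fr2).
  have {}Inv1 : Inv p s2 by move=> q qp; rewrite !(frame_arr fr2) //; exact: Inv1.
  have s22 : var s2 2 = p by rewrite (frame_var fr2).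
  apply: runs_seq; apply: runs_put.
  have done x : x = Num.min (release p) (D + 1) ->
      Inv p.+1 (set_arr (set_arr s2 6 (rank p : nat) (p : nat)) 7 (rank p : nat) x).
    move=> -> q; rewrite ltnS leq_eqVlt => /orP[/eqP/val_inj-> | qp].
      by rewrite /= eqxx.
    have : (rank q == rank p :> nat) = false.
      by rewrite (inj_eq (@ord_inj _)) (inj_eq (@rank_inj _ _)) -(inj_eq val_inj) ltn_eqF.
    have := Inv1 q qp; move: (rank q : nat) (rank p : nat) => rq rp /=.
    by rewrite !eqz_nat => + ->.
  apply: runs_if; rewrite /= s22 s2r rel dl => le; apply: runs_put;
    rewrite /= s22 s2r ?rel ?dl; apply: done; lia.
move=> s1 fr Inv1; apply: runs_put; split.
- by rewrite /= (frame_var fr).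
- by move=> j; have [] := Inv1 (packet j) (ltn_ord _); rewrite packetK.
- by move=> j; rewrite /= (frame_arr fr) //; exact: table_ord.
- by move=> i; rewrite /= (frame_arr fr) //; exact: table_ord.
move=> k kn; rewrite /= (frame_var fr) // (frame_arr fr) //= eqz_nat.
have [->|ne] := eqVneq k n.
  by rewrite clock_end -first_deadline.
have ltkn : (k < n)%N by lia.
have [_] := Inv1 (packet (Ordinal ltkn)) (ltn_ord _).
by rewrite packetK (clock_ord D (Ordinal ltkn)).
Qed.

Lemma runs_reset_counts s (P : store -> Prop) : ready s ->
  (forall s', frame reset_counts s s' -> (forall j, arr s' 8 (buf j : nat) = 0) -> P s') ->
  runs reset_counts s P.
Proof.
move=> rd post; apply: (runs_frame (Q := fun s' => forall j, arr s' 8 (buf j : nat) = 0));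
  last by move=> s'; apply: post.
apply: (runs_for (Inv := fun k s' => forall j, (j < k)%N -> arr s' 8 (buf j : nat) = 0)) => //.
- exact: ready_n.
- move=> j s1 s10 s13 fr Inv1; apply: runs_put => /= j'.
  have rd1 := ready_frame fr isT rd.
  rewrite s13 (ready_packet rd1) (ready_buffer rd1) ltnS leq_eqVlt.
  by case/orP=> [/eqP/val_inj->|/Inv1->]; rewrite ?eqxx //; case: ifP.
by move=> s1 fr Inv1 j; apply: Inv1.
Qed.

Definition accepted A s : Prop := forall j, arr s 4 (packet j : nat) = (j \in A).

(** Restricted to buffers designated by some packet, the only ones that [reset_counts] clears. *)
Definition counted A k s : Prop := forall j, arr s 8 (buf j : nat) = #|before buf A (buf j) k|.

Lemma counted_put A j s : counted A j s -> j \in A ->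
  counted A j.+1 (set_arr s 8 (buf j : nat) (arr s 8 (buf j : nat) + 1)).
Proof.
move=> cnt jA j'; rewrite /= cnt card_beforeS jA /= eqz_nat.
rewrite (inj_eq val_inj) eq_sym; have [->|_] := eqVneq (buf j) (buf j').
  by rewrite PoszD.
by rewrite addn0 cnt.
Qed.

Lemma counted_skip A j s : counted A j s -> j \notin A -> counted A j.+1 s.
Proof. by move=> cnt /negPf jA j'; rewrite cnt card_beforeS jA addn0. Qed.

(** * The selection phase *)

Section Select.

Variables (p : 'I_n) (A : {set 'I_n}).
Hypothesis Ap : {in A, forall j, (p <= j)%N}.

Let fits_at l := fits buf B T A p l.

Record scanning k s : Prop := Scanning {
  scanning_limit : var s 7 = n;
  scanning_counted : counted A k s;
  scanning_overflow : var s 5 = (\sum_i (#|before buf A i k| - B i))%N;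
  scanning_size : var s 6 = #|[set j in 'I_n | (j \in A) && (j < k)%N]|;
  scanning_fits : forall l, (p <= l < k)%N -> fits_at l
}.

Definition stopped s : Prop := exists l : 'I_n,
  [/\ var s 7 = l, counted A l.+1 s, (p <= l)%N, ~~ fits_at l &
      forall l', (p <= l' < l)%N -> fits_at l'].

Lemma runs_scan s (P : store -> Prop) : ready s -> accepted A s -> var s 4 = p ->
  scanning 0 s ->
  (forall s', frame scan s s' -> scanning n s' \/ stopped s' -> P s') ->
  runs scan s P.
Proof.
move=> rd acc s4 sc post.
apply: (runs_frame (Q := fun s' => scanning n s' \/ stopped s')); last by move=> s'; apply: post.
apply: (runs_for (Inv := fun k s' => scanning k s' \/ stopped s')) => //.
- exact: ready_n.
- by move=> k s1 z [[]|[l []]]; [left|right; exists l].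
- by left.
move=> j s1 s10 s13 fr Inv1; have rd1 := ready_frame fr isT rd.
have {}s4 : var s1 4 = p by rewrite (frame_var fr).
have {}acc : accepted A s1 by move=> j'; rewrite (frame_arr fr).
apply: runs_if; rewrite /= s10 s13 s4 => go; last first.
  apply: runs_skip; case: Inv1 => [sc1|st1]; last by right.
  left; case: sc1 => lim cnt ov sz ok; rewrite lim lexx andbT in go.
  have jA : j \notin A by apply/negP=> /Ap; lia.
  split=> //; first exact: counted_skip.
  - by rewrite sum_beforeS (negPf jA) addn0.
  - by rewrite card_belowS (negPf jA) addn0.
  - by move=> l pl; have := go; lia.
case: Inv1 => [[lim cnt ov sz ok]|[l [lim _ _ _ _]]]; last first.
  by move: go; rewrite lim; have := ltn_ord l; lia.
have pj : (p <= j)%N by lia.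
apply: runs_seq.
apply: (runs_frame (Q := fun s' => [/\ counted A j.+1 s',
    var s' 5 = (\sum_i (#|before buf A i j.+1| - B i))%N &
    var s' 6 = #|[set j' in 'I_n | (j' \in A) && (j' < j.+1)%N]|])).
  apply: runs_if; rewrite /= s13 (ready_packet rd1) acc => jA; last first.
    have {}jA : j \notin A by case: (j \in A) jA.
    apply: runs_skip; split; first exact: counted_skip.
      by rewrite sum_beforeS (negPf jA) addn0.
    by rewrite card_belowS (negPf jA) addn0.
  have {}jA : j \in A by case: (j \in A) jA.
  apply: runs_seq; apply: runs_put; apply: runs_seq; apply: runs_assign.
  rewrite /= s13 (ready_packet rd1) (ready_buffer rd1).
  have cnt' := counted_put cnt jA.
  have size' : var s1 6 + 1 = #|[set j' in 'I_n | (j' \in A) && (j' < j.+1)%N]|.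
    by rewrite sz card_belowS jA PoszD.
  apply: runs_if; rewrite /= s13 (ready_packet rd1) (ready_buffer rd1) (ready_capacity rd1);
    move: (cnt' j) => /= ->; rewrite lez_nat -ltnNge => full.
    by apply: runs_assign; split=> //=; rewrite ov sum_beforeS jA full PoszD.
  by apply: runs_skip; split=> //=; rewrite ov sum_beforeS jA (negPf full) addn0.
move=> s2 fr2 [cnt2 ov2 sz2].
(* No packet of [A] precedes [p], so the counts from the beginning are those of the window starting
   at [p]. *)
have fitsE : fits_at j = ~~ (T j - T p < var s2 5).
  by rewrite /fits_at /fits (overflow_before buf B Ap (ltn_ord j)) -ov2 leNgt.
have rd2 := ready_frame fr2 isT rd1.
have s23 : var s2 3 = j by rewrite (frame_var fr2).
have s24 : var s2 4 = p by rewrite (frame_var fr2).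
apply: runs_if; rewrite /= s23 s24
  !(ready_clock rd2) ?(ltnW (ltn_ord _)) // => viol.
  apply: runs_assign; right; exists j; split=> //=.
  by rewrite fitsE negbK ltNge.
apply: runs_skip; left; split=> //; first by rewrite (frame_var fr2).
move=> l; rewrite ltnS (leq_eqVlt l) => /andP[pl /orP[/eqP->|lj]]; last by apply: ok; rewrite pl.
by rewrite fitsE ltNge.
Qed.

End Select.

Lemma accepted_test A s j : ready s -> accepted A s ->
  ~~ (arr s 4 (arr s 6 (j : nat)) <= 0) = (j \in A).
Proof. by move=> rd acc; rewrite (ready_packet rd) acc; case: (j \in A). Qed.

Lemma weight_ge0 j : 0 <= weight j.
Proof. exact: value_ge0. Qed.

Lemma input_weight j : input_values I (packet j : nat) = weight j.
Proof. exact: table_ord. Qed.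

Lemma runs_find_cheapest s A (C : {set 'I_n}) q0 (P : store -> Prop) : ready s -> accepted A s ->
  (forall j, (j \in C) = [&& j \in A, j%:Z <= var s 7 &
     ~~ ((var s 7 < n) && (arr s 8 (buf j : nat) <= B (buf j)))]) ->
  var s 8 = q0 -> q0 \in C ->
  (forall s' q, frame find_cheapest s s' -> var s' 8 = q -> q \in C ->
     {in C, forall j, weight q <= weight j} -> P s') ->
  runs find_cheapest s P.
Proof.
move=> rd acc CE s8 q0C post.
pose Inv k s' := exists q, [/\ q \in C, var s' 8 = q &
  {in C, forall j, (j < k)%N -> weight q <= weight j}].
apply: (runs_frame (Q := Inv n)); last first.
  by move=> s' fr [q [qC s'8 qmin]]; apply: (post _ q) => // j jC; apply: qmin.
apply: (runs_for (Inv := Inv)) => //.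
- exact: ready_n.
- by exists q0.
move=> j s1 s10 s13 fr [q [qC s18 qmin]]; have rd1 := ready_frame fr isT rd.
have {}acc : accepted A s1 by move=> j'; rewrite (frame_arr fr).
have jCE : (j \in C) = [&& j \in A, j%:Z <= var s1 7 &
     ~~ ((var s1 7 < n) && (arr s1 8 (buf j : nat) <= B (buf j)))].
  by rewrite CE (frame_var fr) // (frame_arr fr).
have min_next q' : {in C, forall j', (j' < j)%N -> weight q' <= weight j'} ->
    (j \in C -> weight q' <= weight j) ->
    {in C, forall j', (j' < j.+1)%N -> weight q' <= weight j'}.
  move=> q'min q'j j' j'C; rewrite ltnS leq_eqVlt.
  by case/orP=> [/eqP/val_inj jj|]; [rewrite jj; apply: q'j; rewrite -jj|exact: q'min].
have testE : eval_test (input_values I) s1 (And (Accepted 3)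
        (And (Le (Var 3) (Var 7))
        (And (Not (And (Lt (Var 7) (Var 0)) (Le (Count 3) (Capacity 3))))
             (Not (LeValue (Packet 8) (Packet 3)))))) =
    (j \in C) && ~~ (weight q <= weight j).
  rewrite jCE /= s10 s13 s18 (accepted_test _ rd1 acc) !(ready_packet rd1) (ready_buffer rd1).
  by rewrite (ready_capacity rd1) !input_weight -ltNge -!andbA.
apply: runs_if; rewrite testE; [case/andP=> jC lt|move=> le].
  apply: runs_assign; exists j; split=> //.
  apply: min_next => // j' j'C j'j; apply: le_trans (qmin _ j'C j'j).
  by apply/ltW; rewrite ltNge.
apply: runs_skip; exists q; split=> //; apply: min_next => // jC.
by move: le; rewrite jC negbK.
Qed.

Lemma accepted_put A s j (b : bool) : accepted A s ->
  accepted (if b then j |: A else A :\ j) (set_arr s 4 (packet j : nat) b).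
Proof.
move=> acc j'; rewrite /= eqz_nat (inj_eq (@ord_inj _)) (inj_eq (@packet_inj _ _)).
by case: b; rewrite !inE; have [|] := eqVneq j' j.
Qed.

Lemma runs_select_packet s p A (P : store -> Prop) : ready s -> accepted A s -> var s 4 = p ->
  best buf B T (@weight R I) p.+1 A ->
  (forall s' A', accepted A' s' -> best buf B T (@weight R I) p A' -> P s') ->
  runs select_packet s P.
Proof.
move=> rd acc s4 bestA post; have [Ap hallA _] := bestA.
have pA : p \notin A by apply/negP=> /Ap; rewrite ltnn.
have A1p : {in p |: A, forall j, (p <= j)%N}.
  by move=> j; rewrite !inE => /orP[/eqP->|/Ap/ltnW].
apply: runs_seq; apply: runs_put; rewrite /= s4 (ready_packet rd).
set s1 := set_arr _ _ _ _.
have acc1 : accepted (p |: A) s1 := accepted_put p true acc.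
have rd1 : ready s1 by case: rd.
apply: runs_seq; apply: runs_reset_counts => // s2 fr2 count2.
have rd2 := ready_frame fr2 isT rd1.
apply: runs_seq; apply: runs_assign; apply: runs_seq; apply: runs_assign.
apply: runs_seq; apply: runs_assign; apply: runs_seq.
set s3 := set_var _ _ _.
have rd3 : ready s3 by case: rd2.
have acc3 : accepted (p |: A) s3 by move=> j; rewrite /= (frame_arr fr2).
have s34 : var s3 4 = p by rewrite /= (frame_var fr2).
apply: (runs_scan A1p rd3 acc3 s34).
  have before0 (X : {set 'I_n}) i : before buf X i 0 = set0.
    by apply/setP=> j; rewrite !inE !andbF.
  split=> /=.
  - exact: ready_n.
  - by move=> j; rewrite before0 cards0 /= count2.
  - by rewrite big1 // => i _; rewrite before0 cards0.
  - by rewrite eq_card0 // => j; rewrite !inE andbF.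
  - by move=> l; rewrite ltn0 andbF.
move=> s5 fr5 scan5; have rd5 := ready_frame fr5 isT rd3.
have s54 : var s5 4 = p by rewrite (frame_var fr5).
have acc5 : accepted (p |: A) s5 by move=> j; rewrite (frame_arr fr5) // acc3.
have fits_end : fits buf B T (p |: A) p n = (#|p |: A|%:Z <= T n - T p).
  by rewrite /fits overflow_end.
have clock_p k : (k <= n)%N -> arr s5 7 k = T k by apply: ready_clock.
apply: runs_if; rewrite /= (ready_n rd5) s54 !clock_p ?(ltnW (ltn_ord p)) // => done.
  apply: runs_skip; apply: (post _ (p |: A)) => //.
  case: scan5 => [[lim _ _ sz ok]|[l [lim _ _ _ _]]]; last first.
    by move: done; rewrite lim; have := ltn_ord l; lia.
  apply: best_accept bestA _; [exact: weight_ge0|].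
  apply: (hallU1 T_mono) => // [j /Ap/ltnW //|l /andP[pl]].
  rewrite leq_eqVlt => /orP[/eqP->|ln]; last by apply: ok; rewrite pl.
  move: done; rewrite fits_end sz lim lexx /=; congr (_ <= _); congr Posz.
  by apply: eq_card => j; rewrite !inE ltn_ord andbT.
(* Both ways to fail, a stopped scan or too many packets before the end of time, yield the first
   violated end [l], held by variable 7, and a circuit that the test of [find_cheapest]
   recognizes. *)
have [l [s57 pl ln viol [first circE]]] : exists l, [/\ var s5 7 = l%:Z, (p <= l)%N, (l <= n)%N,
    ~~ fits buf B T (p |: A) p l & (forall l', (p <= l' < l)%N -> fits buf B T (p |: A) p l')
    /\ forall j, (j \in circuit buf B (p |: A) p l) = [&& j \in p |: A, j%:Z <= var s5 7 &
     ~~ ((var s5 7 < n) && (arr s5 8 (buf j : nat) <= B (buf j)))]].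
  case: scan5 => [[lim cnt _ sz ok]|[l [lim cnt pl viol ok]]]; last first.
    exists l; split=> //; first exact: ltnW.
    split=> // j; rewrite inE lim cnt /cap ltn_ord (window_before _ _ _ A1p).
    case jA1: (j \in _) => //=; rewrite A1p // !lez_nat ltz_nat ltn_ord /=.
    by rewrite -ltnNge.
  exists n; split; rewrite ?(ltnW (ltn_ord p)) //.
    rewrite fits_end; move: done; rewrite lim lexx sz /=; congr (~~ (_ <= _)); congr Posz.
    by apply: eq_card => j; rewrite !inE ltn_ord andbT.
  split=> // j; rewrite inE lim ltxx /= /cap ltnn.
  case jA1: (j \in _) => //=; rewrite A1p // lez_nat (ltnW (ltn_ord j)) /=.
  by apply/card_gt0P; exists j; rewrite in_window jA1 eqxx A1p // ltnW.
apply: runs_seq; apply: runs_assign; apply: runs_seq.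
have rd6 : ready (set_var s5 8 (eval s5 (Var 4))) by case: rd5.
have pln : (p <= l <= n)%N by rewrite pl.
apply: (runs_find_cheapest (q0 := p) rd6 acc5 circE).
- by rewrite /= s54.
- exact: mem_circuit hallA pln viol.
move=> s7 q fr7 s78 qC qmin; have rd7 := ready_frame fr7 isT rd6.
apply: runs_put; rewrite /= s78 (ready_packet rd7); apply: post.
  by apply: (accepted_put q false) => j; rewrite (frame_arr fr7) //; apply: acc5.
by apply: (best_replace T_mono) bestA _ pln viol first qC qmin.
Qed.

Lemma runs_select_packets s (P : store -> Prop) : ready s -> accepted set0 s ->
  (forall s' A, frame select_packets s s' -> accepted A s' ->
     best buf B T (@weight R I) 0 A -> P s') ->
  runs select_packets s P.
Proof.
move=> rd acc0 post.
pose Inv k s' := exists2 A, accepted A s' & best buf B T (@weight R I) (n - k) A.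
apply: (runs_frame (Q := Inv n)).
  apply: (runs_for (Inv := Inv)) => //.
  - exact: ready_n.
  - exists set0 => //; rewrite subn0; apply: best_init; [exact: T_mono|exact: weight_ge0].
  move=> j s1 s10 s12 fr [A acc bestA]; have rd1 := ready_frame fr isT rd.
  apply: runs_seq; apply: runs_assign.
  apply: (runs_select_packet (p := rev_ord j) (A := A)).
  - by case: rd1.
  - exact: acc.
  - by rewrite /= s10 s12; have := ltn_ord j; lia.
  - by rewrite /= -subSn.
  by move=> s2 A' acc' best'; exists A'.
by move=> s' fr [A acc bestA]; apply: post fr acc _; rewrite -(subnn n).
Qed.

(** * The sending phases *)

Definition sent_time s j : int := arr s 5 (packet j : nat).

Record timetable S s : Prop := Timetable {
  timetable_sent : forall j, arr s 10 (j : nat) = (j \in S);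
  timetable_busy : forall y, 0 < arr s 9 y <-> exists2 j, j \in S & sent_time s j = y
}.

Lemma timetable_frame c S s s' : frame c s s' ->
  all (fun a => a \notin writes_arr c) [:: 5; 9; 10]%N -> timetable S s -> timetable S s'.
Proof.
move=> fr /and4P[a5 a9 a10 _] [sent busy]; split=> [j|y].
  by rewrite (frame_arr fr).
rewrite (frame_arr fr) // busy; split=> -[j jS jy]; exists j => //; move: jy;
  by rewrite /sent_time (frame_arr fr).
Qed.

(** Since [h] is not in [S], fewer than [n] slots are taken, and [n] attempts reach the earliest
    free one. *)
Lemma runs_send_packet s S h (P : store -> Prop) : ready s -> timetable S s ->
  var s 8 = h -> h \notin S ->
  (forall s' x, frame send_packet s s' -> timetable (h |: S) s' -> T h <= x ->
     (forall y, T h <= y < x -> exists2 j, j \in S & sent_time s j = y) ->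
     {in S, forall j, sent_time s j <> x} ->
     sent_time s' h = x -> (forall j, j != h -> sent_time s' j = sent_time s j) -> P s') ->
  runs send_packet s P.
Proof.
move=> rd [sent busy] s8 hS post.
pose Q s' := exists x, [/\ timetable (h |: S) s', T h <= x,
     (forall y, T h <= y < x -> exists2 j, j \in S & sent_time s j = y),
     {in S, forall j, sent_time s j <> x} &
     sent_time s' h = x /\ (forall j, j != h -> sent_time s' j = sent_time s j)].
apply: (runs_frame (Q := Q)) => [|s' fr [x [tt hx full free [s'h s'E]]]]; last first.
  exact: (post _ x).
apply: runs_seq; apply: runs_assign; rewrite /= s8 (ready_clock rd) ?(ltnW (ltn_ord h)) //.
apply: runs_seq.
(* Either all [k] slots tried so far are busy and [x] is the next one, or [x] has already stopped at
   a free slot. *)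
pose Inv k s' := exists x, [/\ var s' 9 = x, T h <= x <= T h + k%:Z,
  (forall y, T h <= y < x -> 0 < arr s 9 y) & x < T h + k%:Z -> ~~ (0 < arr s 9 x)].
apply: (runs_for (Inv := Inv)) => //.
- exact: ready_n rd.
- by exists (T h); split=> //=; lia.
- move=> k s1 s10 s13 fr [x [s19 hx full free]].
  have s1E y : arr s1 9 y = arr s 9 y by rewrite (frame_arr fr).
  apply: runs_if; rewrite /= s19 s1E -ltNge => busy_x.
    have xE : x = T h + k%:Z.
      by have [/free|] := ltP x (T h + k%:Z); [rewrite busy_x|lia].
    apply: runs_assign; exists (x + 1); split=> /=; [by rewrite s19|lia| |lia].
    by move=> y yx; have [->//|yN] := eqVneq y x; apply: full; lia.
  by apply: runs_skip; exists x; split=> //; lia.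
move=> s1 fr [x [s19 /andP[hx xn] full free]].
have full' y : T h <= y < x -> exists2 j, j \in S & sent_time s j = y.
  by move=> /full /busy.
have {}free : ~~ (0 < arr s 9 x).
  apply: free; rewrite lt_neqAle xn andbT; apply/eqP=> xE.
  have : (n <= #|S|)%N by apply: (@card_busy _ _ (sent_time s) (T h)); rewrite -xE.
  rewrite leqNgt; apply/negP; rewrite negbK -[X in (_ < X)%N]card_ord -cardsT.
  by apply: proper_card; rewrite properT; apply: contraNneq hS => ->; rewrite inE.
have rd1 : ready s1.
  by apply: ready_frame fr isT _; case: rd.
have s18 : var s1 8 = h by rewrite (frame_var fr).
have s1sent j : arr s1 10 (j : nat) = (j \in S) by rewrite (frame_arr fr) //= sent.
have s1busy y : arr s1 9 y = arr s 9 y by rewrite (frame_arr fr).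
have s1time j : arr s1 5 (packet j : nat) = sent_time s j by rewrite (frame_arr fr).
apply: runs_seq; apply: runs_put; apply: runs_seq; apply: runs_put; apply: runs_put.
rewrite /= s18 s19 (ready_packet rd1); set s2 := set_arr _ _ _ _.
have time2 j : sent_time s2 j = if j == h then x else sent_time s j.
  by rewrite /sent_time /= s1time eqz_nat (inj_eq (@ord_inj _)) (inj_eq (@packet_inj _ _)).
exists x; split=> //.
- split=> [j|y].
    by rewrite /= s1sent eqz_nat (inj_eq (@ord_inj _)) !inE; case: (j == h).
  have -> : arr s2 9 y = if y == x then 1 else arr s 9 y by rewrite /= s1busy.
  have [->|yx] := eqVneq y x.
    by split=> // _; exists h; rewrite ?setU11 // time2 eqxx.
  rewrite busy; split=> -[j].
    move=> jS jy; exists j; first by rewrite !inE jS orbT.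
    by rewrite time2; case: eqP => // jh; rewrite -jh jS in hS.
  rewrite time2 !inE; case: eqP => [_ _ xy|_ /= jS jy]; last by exists j.
  by rewrite xy eqxx in yx.
- by move=> j jS jx; case/negP: free; apply/busy; exists j.
by split=> [|j /negPf jh]; rewrite time2 ?eqxx ?jh.
Qed.

(** The witness [j0] guarantees that the search succeeds; the value [n] of variable 8 marks that
    nothing has been found yet. *)
Lemma runs_find_head s A S q j0 (P : store -> Prop) : ready s -> accepted A s ->
  (forall j, arr s 10 (j : nat) = (j \in S)) -> var s 2 = q ->
  j0 \in A -> j0 \notin S -> buf j0 = buf q ->
  (forall s' h, frame find_head s s' -> var s' 8 = h -> h \in A -> h \notin S ->
     buf h = buf q -> {in A, forall j, buf j = buf q -> (j < h)%N -> j \in S} -> P s') ->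
  runs find_head s P.
Proof.
move=> rd acc sent s2 j0A j0S j0q post.
pose none k := {in A, forall j, buf j = buf q -> (j < k)%N -> j \in S}.
pose Inv k s' := (var s' 8 = n /\ none k) \/
  exists h, [/\ var s' 8 = h, h \in A, h \notin S, buf h = buf q & none h].
apply: (runs_frame (Q := Inv n)); last first.
  move=> s' fr [[_ no]|[h [s'8 hA hS hq head]]]; last exact: (post _ h).
  by rewrite no in j0S.
apply: runs_seq; apply: runs_assign; rewrite /= (ready_n rd).
apply: (runs_for (Inv := Inv)) => //.
- exact: ready_n rd.
- by left.
- move=> j s1 s10 s13 fr Inv1.
  have rd1 : ready s1 by apply: ready_frame fr isT _; case: rd.
  have {}acc : accepted A s1 by move=> j'; rewrite (frame_arr fr) //=; exact: acc.
  have {}sent : arr s1 10 (j : nat) = (j \in S) by rewrite (frame_arr fr) //= sent.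
  have {}s2 : var s1 2 = q by rewrite (frame_var fr) //= s2.
  case: Inv1 => [[s18 no]|[h [s18 hA hS hq head]]]; last first.
    apply: runs_if; rewrite /= s10 s18 => go; last by apply: runs_skip; right; exists h.
    by case/andP: go; rewrite lez_nat leqNgt ltn_ord.
  have testE : eval_test (input_values I) s1 (And (Le (Var 0) (Var 8))
        (And (Accepted 3)
        (And (Not (Sent 3))
        (And (Le (Buffer 3) (Buffer 2)) (Le (Buffer 2) (Buffer 3)))))) =
      [&& j \in A, j \notin S & buf j == buf q].
    rewrite /= s10 s18 s13 s2 lexx (accepted_test _ rd1 acc) !(ready_packet rd1).
    by rewrite !(ready_buffer rd1) sent -eq_le eqz_nat (inj_eq val_inj); case: (j \in S).
  apply: runs_if; rewrite testE; [case/and3P=> jA jS /eqP jq|move=> out].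
    by apply: runs_assign; right; exists j.
  apply: runs_skip; left; split=> // j' j'A j'q; rewrite ltnS leq_eqVlt.
  case/orP=> [/eqP/val_inj jj|]; last exact: no.
  by move: out; rewrite -jj j'A j'q eqxx andbT negbK.
Qed.

Section Send.

Variable A : {set 'I_n}.
Hypothesis hallA : hall buf B T A.

Lemma runs_send_overflowing s (P : store -> Prop) : ready s -> accepted A s ->
  timetable set0 s -> (forall j, arr s 8 (buf j : nat) = 0) ->
  (forall s' S, frame send_overflowing s s' -> timetable S s' ->
     arrivals buf B T A n S (sent_time s') -> P s') ->
  runs send_overflowing s P.
Proof.
move=> rd acc tt0 count0 post.
pose Inv k s' := exists S, [/\ timetable S s', counted A k s' &
  arrivals buf B T A k S (sent_time s')].
apply: (runs_frame (Q := Inv n)); last by move=> s' fr [S [tt _ arr]]; apply: post arr.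
apply: (runs_for (Inv := Inv)) => //.
- exact: ready_n rd.
- by move=> k s1 z [S [[sent busy] cnt arrS]]; exists S.
- exists set0; split=> //; last exact: arrivals0.
  by move=> j; rewrite count0 eq_card0 // => j'; rewrite !inE !andbF.
move=> q s1 s10 s12 fr [S [tt cnt arrS]]; have rd1 := ready_frame fr isT rd.
have {}acc : accepted A s1 by move=> j; rewrite (frame_arr fr).
apply: runs_if; rewrite /= s12 (accepted_test _ rd1 acc) => qA; last first.
  apply: runs_skip; exists S; split=> //; first exact: counted_skip.
  exact: (arrivals_skip T_mono arrS qA).
apply: runs_seq; apply: runs_put.
rewrite /= s12 (ready_packet rd1) (ready_buffer rd1).
set s2 := set_arr _ _ _ _; have cnt2 : counted A q.+1 s2 := counted_put cnt qA.
have rd2 : ready s2 by case: rd1.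
have tt2 : timetable S s2 by case: tt.
have acc2 : accepted A s2 by [].
apply: runs_if; rewrite [eval_test _ _ _]/= s12 (ready_packet rd1) (ready_buffer rd1)
    (ready_capacity rd1); move: (cnt2 q) => /= ->; rewrite lez_nat -ltnNge => full; last first.
  apply: runs_skip; exists S; split=> //.
  by apply: (arrivals_keep T_mono arrS qA); rewrite leqNgt.
have [j0 [j0A j0S j0q _]] := arrivals_head arrS qA full.
apply: runs_seq; apply: (runs_find_head (A := A) (S := S) (q := q) (j0 := j0) rd2) => //.
  exact: timetable_sent tt2.
move=> s3 h fr3 s38 hA hS hq head; have rd3 := ready_frame fr3 isT rd2.
have time3 j : sent_time s3 j = sent_time s1 j by rewrite /sent_time (frame_arr fr3).
apply: (runs_send_packet rd3 (timetable_frame fr3 isT tt2) s38 hS).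
move=> s4 x fr4 tt4 hx busy free s4h s4E; exists (h |: S); split=> //.
  by move=> j; rewrite (frame_arr fr4) // (frame_arr fr3) //; apply: cnt2.
apply: (arrivals_eject T_mono hallA arrS qA full hA hS hq head hx).
- by move=> y /busy[j jS jy]; exists j; rewrite // -time3.
- by move=> j jS; rewrite -time3; apply: free.
- by [].
- by move=> j jh; rewrite s4E.
Qed.

Lemma runs_send_remaining s S (P : store -> Prop) : ready s -> accepted A s ->
  timetable S s -> arrivals buf B T A n S (sent_time s) ->
  (forall s', frame send_remaining s s' ->
     flushing buf B T A n A (sent_time s') -> P s') ->
  runs send_remaining s P.
Proof.
move=> rd acc tt arrS post.
pose Inv k s' := exists2 S, timetable S s' & flushing buf B T A k S (sent_time s').
apply: (runs_frame (Q := Inv n)); last first.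
  move=> s' fr [S' _ fl]; apply: post => //.
  have S'A : S' = A.
    apply/eqP; rewrite eqEsubset (slots_sub (flushing_slots fl)) /=.
    by apply/subsetP=> j jA; apply: (flushing_served fl).
  by rewrite S'A in fl.
apply: (runs_for (Inv := Inv)) => //.
- exact: ready_n rd.
- by move=> k s1 z [S' [sent busy] fl]; exists S'.
- by exists S => //; exact: flushing0.
move=> h s1 s10 s12 fr [S' tt1 fl]; have rd1 := ready_frame fr isT rd.
have {}acc : accepted A s1 by move=> j; rewrite (frame_arr fr).
have testE : eval_test (input_values I) s1 (And (Accepted 2) (Not (Sent 2))) =
    (h \in A) && (h \notin S').
  by rewrite /= s12 (accepted_test _ rd1 acc) (timetable_sent tt1); case: (h \in S').
apply: runs_if; rewrite testE; [case/andP=> hA hS|move=> skip]; last first.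
  by apply: runs_skip; exists S' => //; exact: flushing_skip.
apply: runs_seq; apply: runs_assign; set s2 := set_var _ _ _.
have rd2 : ready s2 by case: rd1.
have tt2 : timetable S' s2 by case: tt1.
apply: (runs_send_packet rd2 tt2 _ hS) => // s3 x fr3 tt3 hx busy free s3h s3E.
exists (h |: S') => //.
exact: (flushing_eject T_mono hallA fl hA hS hx).
Qed.

End Send.

(** * The whole program and its running time *)

Lemma runs_program :
  runs program (input I) (fun s => optimal (output I s)).
Proof.
apply: runs_seq; apply: runs_sort_packets => s1 rd1 fr1.
have zero a : (a \notin writes_arr sort_packets) && (3 < a)%N -> forall k, arr s1 a k = 0.
  by move=> /andP[a1 a3] k; rewrite (frame_arr fr1) //; case: a a1 a3 => [|[|[|[|]]]].
apply: runs_seq; apply: runs_select_packets => // [j|s2 A fr2 acc2 bestA].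
  by rewrite zero // inE.
have rd2 := ready_frame fr2 isT rd1; have [_ hallA _] := bestA.
apply: runs_seq; apply: runs_reset_counts => // s3 fr3 count3.
have rd3 := ready_frame fr3 isT rd2.
have acc3 : accepted A s3 by move=> j; rewrite (frame_arr fr3).
have zero3 a : [&& a \notin writes_arr reset_counts, a \notin writes_arr select_packets,
    a \notin writes_arr sort_packets & 3 < a]%N -> forall k, arr s3 a k = 0.
  case/and3P=> a3 a2 a1 k.
  by rewrite (frame_arr fr3 _ a3) (frame_arr fr2 _ a2) zero.
apply: runs_seq; apply: (runs_send_overflowing hallA rd3 acc3) => // [|s4 S fr4 tt4 arr4].
  split=> [j|y]; first by rewrite zero3 // inE.
  by rewrite zero3 //; split=> // -[j]; rewrite inE.
have rd4 := ready_frame fr4 isT rd3.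
have acc4 : accepted A s4 by move=> j; rewrite (frame_arr fr4).
apply: (runs_send_remaining hallA rd4 acc4 tt4 arr4) => s5 fr5 flush.
apply: (optimal_output deadlineE bestA (time := sent_time s5)) => // j.
by rewrite (frame_arr fr5).
Qed.

End Correctness.

Theorem theorem2 :
  exists (c : cmd) (K : nat),
    forall (R : realDomainType) (I : instance R),
      common_deadline I ->
      exists (t : nat) (s : store),
        exec (input_values I) c (input I) t s /\
        optimal (output I s) /\
        (2 <= npackets I ->
         t <= K * (npackets I ^ 2 * trunc_log 2 (npackets I)))%N.
Proof.
(* Loops are nested at most twice, which gives the factor [n.+1 ^ 2]. It is at most [4 * n ^ 2], and
   the logarithm is at least 1 for [n >= 2]. *)
exists program, (4 * bound 0 program)%N => R I [D' deadlineE].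
(* Without packets every [D] is a common deadline, and the cell read by [sort_packets] has the
   default value 0; choosing that cell as [D] covers this case too. *)
have [|t [s [ex le opt]]] := @runs_program R I (table (@deadline R I) 0) _ erefl.
  move=> p; have n0 : (0 < npackets I)%N by case: (npackets I) p => [[]|].
  by rewrite (table_ord (@deadline R I) (Ordinal n0)) !deadlineE.
exists t, s; split=> //; split=> // n2; apply: leq_trans le _.
have log1 : (0 < trunc_log 2 (npackets I))%N by rewrite trunc_log_gt0.
have := @bound_poly (npackets I) 2 program isT.
move: (bound 0 program) (bound _ program) => K b /leq_trans; apply.
rewrite -mulnA [(K * _)%N]mulnC mulnA leq_mul2r; apply/orP; right.
by move: (npackets I) (trunc_log 2 _) n2 log1 => n l; nia.
Qed.
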